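(* Let $x,\alpha,\beta\in\mathbb{C}$. Assume that $\Re(x)>0$, or assume that either one of $\alpha,\beta$ is an odd integer or $\alpha+\beta$ is an even integer. Then for each $j\in\{1,2,3\}$ $$\frac{\Gamma\left(\frac12(x+\alpha)\right)\Gamma\left(\frac12(x-\alpha-\beta+1)\right)\Gamma\left(\frac12(x+\beta)\right)}{\Gamma\left(\frac12(x-\alpha+2)\right)\Gamma\left(\frac12(x+\alpha+\beta+1)\right)\Gamma\left(\frac12(x-\beta+2)\right)} =\cfrac{2}{\lambda_0(j;x)/2+\mathbf{K}_{m=1}^{\infty}\left(\frac{\kappa_m(j)}{\lambda_m(j;x)}\right)} =\cfrac{2}{(x^2+q_0)/2+\mathbf{K}_{m=1}^{\infty}\left(\frac{p_m}{x^2+q_m}\right)},$$ where the coefficients are as follows (with $m\ge 1$ for $\kappa_{2m},\kappa_{2m-1},\lambda_{2m-1},p_m$ and $m\ge 0$ for $\lambda_{2m},q_m$). For $j=1$: $$\kappa_{2m}(1)=\frac{(2m-2+\alpha+\beta)(2m-1-\alpha)(2m-1-\beta)}{4(2m-1)},\quad \kappa_{2m-1}(1)=\frac{(2m-\alpha-\beta)(2m-1+\alpha)(2m-1+\beta)}{4(2m-1)},$$ $$\lambda_{2m}(1;x)=x^2-1,\quad \lambda_{2m-1}(1;x)=1.$$ For $j=2$: $$\kappa_{2m}(2)=\frac{(2m-2+\alpha+\beta)(2m-1+\alpha)(2m-1+\beta)}{4(2m-1)},\quad \kappa_{2m-1}(2)=\frac{(2m-\alpha-\beta)(2m-1-\alpha)(2m-1-\beta)}{4(2m-1)},$$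 $$\lambda_{2m}(2;x)=x^2-(1-\alpha-\beta)^2,\quad \lambda_{2m-1}(2;x)=1.$$ For $j=3$: $$\kappa_{2m}(3)=\frac{(2m-\alpha-\beta)(2m-1+\alpha)(2m-1-\beta)}{4(2m-1)},\quad \kappa_{2m-1}(3)=\frac{(2m-2+\alpha+\beta)(2m-1-\alpha)(2m-1+\beta)}{4(2m-1)},$$ $$\lambda_{2m}(3;x)=x^2-\beta^2,\quad \lambda_{2m-1}(3;x)=1.$$ Finally, $$p_m=-\frac{(2m-\alpha-\beta)(2m-2+\alpha+\beta)\left((2m-1)^2-\alpha^2\right)\left((2m-1)^2-\beta^2\right)}{16(2m-1)^2},$$ $$q_m=\frac12\left(4m^2+\alpha-\alpha^2+\beta-\beta^2-\alpha\beta\right)+\frac{\alpha\beta(-1+\alpha+\beta)}{2(2m-1)(2m+1)}.$$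
   Context: For complex sequences $(a_n)_{n\ge1}$, $(b_n)_{n\ge0}$, the continued fraction $b_0+\mathbf{K}_{n=1}^{\infty}\left(\frac{a_n}{b_n}\right)=b_0+\cfrac{a_1}{b_1+\cfrac{a_2}{b_2+\cdots}}$ is defined as the limit as $n\to\infty$ of its $n$th approximant $b_0+\mathbf{K}_{k=1}^{n}\left(\frac{a_k}{b_k}\right)=b_0+\cfrac{a_1}{b_1+\cfrac{a_2}{\ddots+\cfrac{a_n}{b_n}}}$. The notation $\cfrac{a_0}{b_0+\mathbf{K}_{m=1}^{\infty}\left(\frac{a_m}{b_m}\right)}$ means $a_0$ divided by $b_0+\mathbf{K}_{m=1}^{\infty}\left(\frac{a_m}{b_m}\right)$. $\Gamma$ is the Gamma function.
   Formalization: The first equality is claimed, unless α or β is an odd integer or α+β is even, only for x≠1 (j=1), x≠1−α−β (j=2), x≠β (j=3): there every λ_{2m}(j;x) is 0 and the κ/λ fraction diverges. *)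

(* Defs.v *)
From HB Require Import structures.
From mathcomp Require Import all_boot all_order all_algebra.
From mathcomp Require Import complex.
From mathcomp Require Import all_classical all_reals all_analysis.
Import Order.TTheory GRing.Theory Num.Theory.
Import numFieldNormedType.Exports.
Set Implicit Arguments.
Unset Strict Implicit.
Unset Printing Implicit Defensive.
Local Open Scope classical_set_scope.
Local Open Scope ring_scope.

HB.instance Definition _ (R : realType) :=
  PseudoPointedMetric.copy R[i] R[i]^o.

(* The Riemann sphere: continued fractions, their approximants and the Gamma
   quotient take values in it, [None] being the point at infinity. *)
Notation sphere R := (one_point_compactification R[i]).

Definition fin_pt (R : realType) (z : R[i]) : sphere R := Some z.

Definition sph_add (R : realType) (b : R[i]) (w : sphere R) : sphere R :=
  if w is Some z then fin_pt (b + z) else None.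

(* a / w.  A zero partial numerator terminates a continued fraction whatever
   its tail is, hence the value 0 when a = 0, even for w = 0. *)
Definition sph_div (R : realType) (a : R[i]) (w : sphere R) : sphere R :=
  if a == 0 then fin_pt 0
  else if w is Some z then (if z == 0 then None else fin_pt (a / z))
  else fin_pt 0.

(* a_m / (b_m + a_(m+1) / (b_(m+1) + ... + a_(m+n-1) / b_(m+n-1))) *)
Fixpoint cf_segment (R : realType) (a b : nat -> R[i]) (m n : nat) : sphere R :=
  if n is n'.+1 then sph_div (a m) (sph_add (b m) (cf_segment a b m.+1 n'))
  else fin_pt 0.

(* b0 is separate from b, whose index starts at 1. *)
Definition cf_approximant (R : realType) (b0 : R[i]) (a b : nat -> R[i])
    (n : nat) : sphere R :=
  sph_add b0 (cf_segment a b 1 n).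

Definition cf_converges (R : realType) (b0 : R[i]) (a b : nat -> R[i]) : Prop :=
  cvg (cf_approximant b0 a b n @[n --> \oo]).

Definition cf_value (R : realType) (b0 : R[i]) (a b : nat -> R[i]) : sphere R :=
  lim (cf_approximant b0 a b n @[n --> \oo]).

(* n ^ z = exp (z * ln n), for n >= 1 *)
Definition nat_cpow (R : realType) (n : nat) (z : R[i]) : R[i] :=
  let t := ln (n%:R : R) in
  (expR (complex.Re z * t))%:C%C *
  (cos (complex.Im z * t) +i* sin (complex.Im z * t))%C.

(* Euler's limit n! n^z / (z (z + 1) ... (z + n)); it defines Gamma at every
   complex z outside {0, -1, -2, ...}. *)
Definition Gamma (R : realType) (z : R[i]) : R[i] :=
  lim ((n`!%:R * nat_cpow n z / \prod_(0 <= k < n.+1) (z + k%:R))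
         @[n --> \oo]).

Definition Gamma_pole (R : realType) (z : R[i]) : Prop :=
  exists k : nat, z = - k%:R.

Section GammaQuotient.
Context {R : realType}.
Implicit Types alpha beta x : R[i].

Definition Gamma_args_num alpha beta x : seq R[i] :=
  [:: (x + alpha) / 2; (x - alpha - beta + 1) / 2; (x + beta) / 2].

Definition Gamma_args_den alpha beta x : seq R[i] :=
  [:: (x - alpha + 2) / 2; (x + alpha + beta + 1) / 2; (x - beta + 2) / 2].

Definition Gamma_quotient_fin alpha beta x : R[i] :=
  (\prod_(z <- Gamma_args_num alpha beta x) Gamma z) /
  (\prod_(z <- Gamma_args_den alpha beta x) Gamma z).

(* The quotient is a meromorphic function of x: where one of the six Gamma
   functions has a pole, its value is the limit in the Riemann sphere. *)
Definition Gamma_quotient alpha beta x : sphere R :=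
  if `[< exists2 z, z \in Gamma_args_num alpha beta x
                          ++ Gamma_args_den alpha beta x & Gamma_pole z >]
  then lim (fin_pt (Gamma_quotient_fin alpha beta z) @[z --> x^'])
  else fin_pt (Gamma_quotient_fin alpha beta x).

End GammaQuotient.

Section Coefficients.
Context {R : realType}.
Variables alpha beta : R[i].

(* kappa_(2m)(j) for m >= 1 *)
Definition kappa_even (j m : nat) : R[i] :=
  let M : R[i] := 2 * m%:R in
  match j with
  | 1 => (M - 2 + alpha + beta) * (M - 1 - alpha) * (M - 1 - beta)
  | 2 => (M - 2 + alpha + beta) * (M - 1 + alpha) * (M - 1 + beta)
  | _ => (M - alpha - beta) * (M - 1 + alpha) * (M - 1 - beta)
  end / (4 * (M - 1)).

(* kappa_(2m-1)(j) for m >= 1 *)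
Definition kappa_odd (j m : nat) : R[i] :=
  let M : R[i] := 2 * m%:R in
  match j with
  | 1 => (M - alpha - beta) * (M - 1 + alpha) * (M - 1 + beta)
  | 2 => (M - alpha - beta) * (M - 1 - alpha) * (M - 1 - beta)
  | _ => (M - 2 + alpha + beta) * (M - 1 - alpha) * (M - 1 + beta)
  end / (4 * (M - 1)).

Definition kappa (j n : nat) : R[i] :=
  if odd n then kappa_odd j n.+1./2 else kappa_even j n./2.

Definition lambda (j : nat) (x : R[i]) (n : nat) : R[i] :=
  if odd n then 1 else
  match j with
  | 1 => x ^+ 2 - 1
  | 2 => x ^+ 2 - (1 - alpha - beta) ^+ 2
  | _ => x ^+ 2 - beta ^+ 2
  end.

Definition p_coef (m : nat) : R[i] :=
  let M : R[i] := 2 * m%:R in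
  - ((M - alpha - beta) * (M - 2 + alpha + beta)
     * ((M - 1) ^+ 2 - alpha ^+ 2) * ((M - 1) ^+ 2 - beta ^+ 2)
     / (16 * (M - 1) ^+ 2)).

Definition q_coef (m : nat) : R[i] :=
  let M : R[i] := 2 * m%:R in
  (4 * m%:R ^+ 2 + alpha - alpha ^+ 2 + beta - beta ^+ 2 - alpha * beta) / 2
  + alpha * beta * (- 1 + alpha + beta) / (2 * (M - 1) * (M + 1)).

Definition odd_integer (z : R[i]) : Prop := exists k : int, z = (2 * k + 1)%:~R.
Definition even_integer (z : R[i]) : Prop := exists k : int, z = (2 * k)%:~R.

(* Equivalently, some kappa_n(j) vanishes, i.e. the fractions terminate. *)
Definition parity_condition : Prop :=
  odd_integer alpha \/ odd_integer beta \/ even_integer (alpha + beta).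

(* At this zero x of lambda_(2m)(j; x), if it lies in Re x > 0 and no
   kappa_n(j) vanishes, the j-th fraction diverges: its approximants of even
   index are all 0, those of odd index do not tend to 0. *)
Definition divergence_point (j : nat) : R[i] :=
  match j with
  | 1 => 1
  | 2 => 1 - alpha - beta
  | _ => beta
  end.

End Coefficients.

(* Main.v *)
Require Import Defs.
From mathcomp Require Import all_boot all_order all_algebra.
From mathcomp Require Import complex.
From mathcomp Require Import all_classical all_reals all_analysis.
From mathcomp Require Import ring lra.
Import Order.TTheory GRing.Theory Num.Theory.
Import numFieldNormedType.Exports.
Import ComplexField.Normc.
Set Implicit Arguments.
Unset Strict Implicit.
Unset Printing Implicit Defensive.
Local Open Scope classical_set_scope.
Local Open Scope ring_scope.

(** Put num(x) = (x + alpha)(x - alpha - beta + 1)(x + beta) and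
    den(x) = (x - alpha + 2)(x + alpha + beta + 1)(x - beta + 2).  The Gamma
    quotient G satisfies num(x) G(x) = den(x) G(x + 2), and G(x) ~ 4 / x^2 as
    Re x grows.  These two properties determine it: iterating the first and
    inserting the second is Euler's product for G.  The proof shows that the
    continued fractions have both properties.

    Numerators and denominators of the approximants are solutions of
    y_n = b_n y_(n-1) + a_n y_(n-2), a recurrence of Wilson polynomials with
    spectral parameter x^2.  Like every Wilson recurrence it is bispectral:
    there is a 2 x 2 matrix T_m(x), polynomial in m and x ([shift_map]), that
    sends the solutions at x to the solutions at x + 2 ([shift_map_step]).
    Here T_0(x) multiplies the initial values of the numerators by num(x) and
    those of the denominators by den(x) ([shift_map0_A], [shift_map0_B]),
    which is where the Gamma quotient comes from.

    Suppose that no partial numerator vanishes and that Re x > 0.  After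
    division by (m!)^2 the recurrence is a perturbation of size O(1 / m^2) of
    an Euler system with exponents 1/2 + x and 1/2 - x, so every solution has a
    coefficient along the growing exponent ([dominant]), and the approximants
    tend to the quotient of the coefficients of numerators and denominators.
    Approximants of even index see that coefficient multiplied by x - d, where
    d is the exceptional point of the j-th fraction; this is why x = d has to
    be excluded for them.  T_m(x) multiplies the dominant coefficient by a
    non-zero scalar ([dominant_shift]), so the functional equation of T_0
    passes to the limit.  If a partial numerator vanishes, T_m(x) is triangular
    at the corresponding place, and the last approximant satisfies the
    functional equation exactly, for every x ([term_shift]).

    The odd approximants of the j-th fraction are the approximants of the
    fraction with the coefficients p_m and x^2 + q_m ([contraction]).  For the
    latter Worpitzky's criterion holds once Re (x^2) is large, with an error
    that is uniform in the length of the fraction ([worpitzky]); this gives the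
    behaviour 4 / x^2.  Where a Gamma function has a pole, the value of the
    quotient is a limit on the sphere: in the non-terminating case it is 0 or
    infinity, read off from the finitely many linear factors that vanish
    ([Gamma_quotient_separated]); in the terminating case the approximant is
    continuous in x ([Gamma_quotient_continuous]). *)

(** * The modulus and limits in the complex numbers *)

Section Modulus.
Context {R : realType}.
Implicit Types z w : R[i].

Lemma normc_ge0 z : 0 <= normc z.
Proof. by case: z => a b; rewrite /normc sqrtr_ge0. Qed.

Lemma normcE z : `|z| = (normc z)%:C%C.
Proof. by case: z => a b; rewrite normc_def. Qed.

Lemma normc_eq0 z : (normc z == 0) = (z == 0).
Proof.
apply/eqP/eqP => [/eq0_normc //|->]; exact: normc0.
Qed.

Lemma normc_gt0 z : (0 < normc z) = (z != 0).
Proof. by rewrite lt_def normc_ge0 normc_eq0 andbT. Qed.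

Lemma normc_distC z w : normc (z - w) = normc (w - z).
Proof. by rewrite -normcN opprB. Qed.

Lemma le_normcB z w : normc z - normc w <= normc (z - w).
Proof.
by rewrite lerBlDr; apply: le_trans (le_normcD _ _); rewrite subrK.
Qed.

Lemma normc_real (a : R) : normc a%:C%C = `|a|.
Proof. by rewrite /normc/= expr0n/= addr0 sqrtr_sqr. Qed.

Lemma normc_nat n : normc (n%:R : R[i]) = n%:R :> R.
Proof. by rewrite -(rmorph_nat (real_complex R)) normc_real ger0_norm. Qed.

Lemma normcX z n : normc (z ^+ n) = normc z ^+ n.
Proof.
elim: n => [|n IH]; first by rewrite !expr0 normc1.
by rewrite !exprS normcM IH.
Qed.

Lemma Re_le_normc z : `|complex.Re z| <= normc z.
Proof.
case: z => a b /=; rewrite -sqrtr_sqr ler_sqrt ?lerDl ?sqr_ge0//.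
by rewrite addr_ge0 ?sqr_ge0.
Qed.

Lemma Im_le_normc z : `|complex.Im z| <= normc z.
Proof.
case: z => a b /=; rewrite -sqrtr_sqr ler_sqrt ?lerDr ?sqr_ge0//.
by rewrite addr_ge0 ?sqr_ge0.
Qed.

Lemma normc_le_ReIm z : normc z <= `|complex.Re z| + `|complex.Im z|.
Proof.
case: z => a b /=; rewrite -[leRHS]ger0_norm ?addr_ge0// -sqrtr_sqr ler_sqrt ?sqr_ge0//.
rewrite sqrrD !real_normK ?num_real// lerD2r lerDl.
by rewrite mulrn_wge0// mulr_ge0.
Qed.

(** The norm of [R[i]] takes values in [R[i]] itself; from here on limits are
    handled through the real-valued modulus [normc]. *)
Lemma cvgcP {T} {F : set_system T} {FF : Filter F} (f : T -> R[i]) (l : R[i]) :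
  (f @ F --> l) <-> (forall e : R, 0 < e -> \forall t \near F, normc (f t - l) < e).
Proof.
split=> [/(@cvgrPdist_lt _ (R[i]^o)) h e e0|h].
  have e0' : 0 < e%:C%C :> R[i] by rewrite ltcR.
  apply: filterS (h _ e0') => t.
  by rewrite normcE ltcR normc_distC.
apply/(@cvgrPdist_lt _ (R[i]^o)) => e e0.
have /complex_realP[k ek] : e \is Num.real by rewrite gtr0_real.
move: e0; rewrite ek ltcR => k0.
apply: filterS (h _ k0) => t.
by rewrite normcE ltcR normc_distC.
Qed.

Lemma cvgcD {T} {F : set_system T} {FF : Filter F} (f g : T -> R[i]) (a b : R[i]) :
  f @ F --> a -> g @ F --> b -> f t + g t @[t --> F] --> a + b.
Proof. exact: (@cvgD _ (R[i]^o)). Qed.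

Lemma cvgcB {T} {F : set_system T} {FF : Filter F} (f g : T -> R[i]) (a b : R[i]) :
  f @ F --> a -> g @ F --> b -> f t - g t @[t --> F] --> a - b.
Proof. exact: (@cvgB _ (R[i]^o)). Qed.

Lemma cvgcM {T} {F : set_system T} {FF : Filter F} (f g : T -> R[i]) (a b : R[i]) :
  f @ F --> a -> g @ F --> b -> f t * g t @[t --> F] --> a * b.
Proof. exact: (@cvgM (R[i])). Qed.

Lemma cvgcV {T} {F : set_system T} {FF : Filter F} (f : T -> R[i]) (a : R[i]) :
  a != 0 -> f @ F --> a -> (f t)^-1 @[t --> F] --> a^-1.
Proof. exact: (@cvgV (R[i])). Qed.

Lemma cvgc_norm {T} {F : set_system T} {FF : Filter F} (f : T -> R[i]) (a : R[i]) :
  f @ F --> a -> normc (f t) @[t --> F] --> normc a.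
Proof.
move=> /cvgcP h; apply/cvgrPdist_lt => e e0; apply: filterS (h _ e0) => t.
apply: le_lt_trans; rewrite ler_norml; apply/andP; split; last first.
  by rewrite normc_distC le_normcB.
by rewrite lerNl opprB le_normcB.
Qed.

Lemma cvgc_unique {T} {F : set_system T} {FF : ProperFilter F} (f : T -> R[i]) (a b : R[i]) :
  f @ F --> a -> f @ F --> b -> a = b.
Proof. exact: (@cvg_unique _ (@norm_hausdorff _ (R[i]^o))). Qed.

Lemma hausdorffC : hausdorff_space R[i].
Proof. exact: (@norm_hausdorff _ (R[i]^o)). Qed.

End Modulus.

(** * The Riemann sphere in homogeneous coordinates *)

Section Sphere.
Context {R : realType}.

Lemma box_compact (M : R) :
  compact [set z : R[i] | -M <= complex.Re z <= M /\ -M <= complex.Im z <= M].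
Proof.
have -> : [set z : R[i] | -M <= complex.Re z <= M /\ -M <= complex.Im z <= M] =
   (fun p : R * R => (p.1 +i* p.2)%C) @` (`[-M, M] `*` `[-M, M]).
  apply/seteqP; split=> [[a b] /= [h1 h2]|_ [[a b] /= [h1 h2] <-]] /=.
    by exists (a, b) => //=; rewrite !in_itv.
  by move: h1 h2; rewrite !in_itv.
apply: continuous_compact; last by apply: compact_setX; exact: segment_compact.
apply: continuous_subspaceT => -[a b]; apply/cvgcP => e e0.
have e2 : 0 < e / 2 by rewrite divr_gt0.
have h1 : (fst : R * R -> R) @ nbhs (a, b) --> a by exact: cvg_fst.
have h2 : (snd : R * R -> R) @ nbhs (a, b) --> b by exact: cvg_snd.
move/cvgrPdist_lt : h1 => /(_ _ e2) h1; move/cvgrPdist_lt : h2 => /(_ _ e2) h2.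
near=> p.
apply: le_lt_trans (normc_le_ReIm _) _ => /=.
rewrite [e]splitr; apply: ltrD.
  by rewrite distrC; near: p.
by rewrite distrC; near: p.
Unshelve. all: by end_near. Qed.

(** Local compactness is what makes the one-point compactification
    Hausdorff, hence limits on the sphere unique. *)
Lemma locally_compactC : locally_compact [set: R[i]].
Proof.
move=> x _; rewrite withinET.
(* A square around 0 that contains the unit disc around x. *)
exists [set z : R[i] | -(normc x + 1) <= complex.Re z <= normc x + 1 /\ -(normc x + 1) <= complex.Im z <= normc x + 1].
  have : x @[x --> x] --> x by [].
  move=> /cvgcP/(_ 1 ltr01); apply: filterS => z zx.
  have zb : normc z <= normc x + 1.
    by rewrite -lerBlDl; apply: le_trans (le_normcB _ _) (ltW zx).
  by split; rewrite -ler_norml; apply: le_trans zb; rewrite ?Re_le_normc ?Im_le_normc.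
split; first exact: box_compact.
apply: compact_closed; [exact: hausdorffC|exact: box_compact].
Qed.

Lemma hausdorff_sphere : hausdorff_space (sphere R).
Proof.
exact: one_point_compactification_hausdorff locally_compactC hausdorffC.
Qed.

Lemma compactC_bounded (K : set R[i]) :
  compact K -> exists M : R, forall z, K z -> normc z <= M.
Proof.
move=> Kc; have /compact_bounded : compact (@normc R @` K).
  apply: continuous_compact Kc; apply: continuous_subspaceT => z.
  exact: (@cvgc_norm _ _ (nbhs z) _ id z).
move=> -[M [_ hM]]; exists (M + 1) => z Kz.
have /= := hM (M + 1) _ _ (imageP _ Kz).
by rewrite ger0_norm ?normc_ge0//; apply; rewrite ltrDl.
Qed.

(** The point of the sphere with homogeneous coordinates [a : b].  Used with
    (a, b) <> (0, 0) only; in these coordinates a division by 0 is harmless,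
    so numerators and denominators of approximants can be treated
    separately. *)
Definition ratio_pt (a b : R[i]) : sphere R := if b == 0 then None else fin_pt (a / b).

Lemma ratio_ptZ c a b : c != 0 -> ratio_pt (c * a) (c * b) = ratio_pt a b.
Proof.
move=> c0; rewrite /ratio_pt mulf_eq0 (negPf c0)/=; case: eqP => // /eqP b0.
by rewrite -mulf_div divff// mul1r.
Qed.

(** Near a point with b = 0 the quotients leave every bounded set, and the
    compact subsets of the plane are bounded; elsewhere this is continuity of
    the quotient. *)
Lemma ratio_pt_cvg {T} {F : set_system T} {FF : Filter F} (A B : T -> R[i]) (a b : R[i]) :
  (a != 0) || (b != 0) -> A @ F --> a -> B @ F --> b ->
  ratio_pt (A t) (B t) @[t --> F] --> ratio_pt a b.
Proof.
move=> ab cA cB; rewrite {2}/ratio_pt; case: eqP => [b0|/eqP b0].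
  have a0 : 0 < normc a by rewrite normc_gt0; move: ab; rewrite b0 eqxx orbF.
  move=> U [K [Kc _] KU]; have [M hM] := compactC_bounded Kc.
  have M0 : 0 < `|M| + 1 by rewrite ltr_wpDl.
  have e1 : 0 < normc a / 2 by rewrite divr_gt0.
  have e2 : 0 < normc a / 2 / (`|M| + 1) by rewrite divr_gt0.
  move/cvgcP : cA => /(_ _ e1) cA; move/cvgcP : cB => /(_ _ e2) cB.
  suff : \forall t \near F, U (ratio_pt (A t) (B t)) by [].
  near=> t; apply: KU; rewrite /ratio_pt; have [_|Bt] := eqVneq (B t) 0; first by right.
  left; exists (A t / B t) => //= /hM; apply/negP; rewrite -ltNge.
  have h1 : normc (A t - a) < normc a / 2 by near: t.
  have h2 : normc (B t - b) < normc a / 2 / (`|M| + 1) by near: t.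
  have h3 := le_normcB a (a - A t); rewrite normc_distC in h1.
  rewrite opprB addrCA subrr addr0 in h3.
  rewrite b0 subr0 ltr_pdivlMr// in h2.
  rewrite normcM normcV ltr_pdivlMr ?normc_gt0//.
  apply: le_lt_trans (_ : normc (B t) * (`|M| + 1) < _); last lra.
  rewrite mulrC ler_wpM2l ?normc_ge0//; apply: le_trans (ler_norm _) _; lra.
have cAB : A t / B t @[t --> F] --> a / b by exact: (cvgcM cA (cvgcV b0 cB)).
have h : fin_pt (A t / B t) @[t --> F] --> fin_pt (a / b).
  by move=> U hU; exact: (cAB _ hU).
apply: cvg_trans h; apply: near_eq_cvg.
have b1 : 0 < normc b by rewrite normc_gt0.
move/cvgcP : cB => /(_ _ b1); apply: filterS => t.
rewrite /ratio_pt; case: eqP => // ->.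
by rewrite sub0r normcN ltxx.
Unshelve. all: by end_near. Qed.

Lemma sphere_lim {T} {F : set_system T} {FF : ProperFilter F} (f : T -> sphere R) l :
  f @ F --> l -> lim (f @ F) = l.
Proof. by apply: cvg_lim; exact: hausdorff_sphere. Qed.

End Sphere.

(** * Summable perturbations of linear recurrences *)

Section Sequences.
Context {R : realType}.

(** w - s increases and w + s decreases along the tail. *)
Lemma real_telescope_cvg (w s : nat -> R) n0 :
  (forall n, 0 <= s n) ->
  (forall n, (n0 <= n)%N -> `|w n.+1 - w n| <= s n - s n.+1) ->
  exists l : R, w @ \oo --> l.
Proof.
move=> s0 h.
have h' k : `|w (k.+1 + n0)%N - w (k + n0)%N| <= s (k + n0)%N - s (k.+1 + n0)%N.
  by rewrite addSn; apply: h; rewrite leq_addl.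
(* The decrements of s bound absolute values, so s is non-increasing from n0 on. *)
have cs : cvgn (fun k => s (k + n0)%N).
  apply: nonincreasing_is_cvgn; last by exists 0 => _ [n _ <-].
  apply/nonincreasing_seqP => k; rewrite -subr_ge0.
  exact: le_trans (normr_ge0 _) (h' k).
have b k : w (k + n0)%N + s (k + n0)%N <= w n0 + s n0.
  elim: k => [|k IH]; first by rewrite add0n.
  apply: le_trans IH; have := h' k; rewrite ler_norml => /andP[_]; lra.
have cv : cvgn (fun k => w (k + n0)%N - s (k + n0)%N).
  apply: nondecreasing_is_cvgn.
    apply/nondecreasing_seqP => k.
    have := h' k; rewrite ler_norml => /andP[+ _]; lra.
  exists (w n0 + s n0) => _ [k _ <-]; have := b k; have := s0 (k + n0)%N; lra.
exists (lim ((fun k => w (k + n0)%N - s (k + n0)%N) @ \oo) + lim ((fun k => s (k + n0)%N) @ \oo)).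
rewrite -(cvg_shiftn n0).
apply: cvg_trans (cvgD cv cs).
by apply: near_eq_cvg; apply: nearW => k /=; rewrite fctE subrK.
Qed.

Lemma telescope_cvg (w : nat -> R[i]) (s : nat -> R) n0 :
  (forall n, 0 <= s n) ->
  (forall n, (n0 <= n)%N -> normc (w n.+1 - w n) <= s n - s n.+1) ->
  exists l : R[i], w @ \oo --> l /\ forall n, (n0 <= n)%N -> normc (l - w n) <= s n.
Proof.
move=> s0 h.
have [a ha] : exists a : R, (fun n => complex.Re (w n)) @ \oo --> a.
  apply: (real_telescope_cvg s0) => n /h; apply: le_trans.
  by rewrite -raddfB; exact: Re_le_normc.
have [b hb] : exists b : R, (fun n => complex.Im (w n)) @ \oo --> b.
  apply: (real_telescope_cvg s0) => n /h; apply: le_trans.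
  by rewrite -raddfB; exact: Im_le_normc.
exists (a +i* b)%C.
have cw : w @ \oo --> (a +i* b)%C.
  apply/cvgcP => e e0; have e2 : 0 < e / 2 by rewrite divr_gt0.
  move/cvgrPdist_lt : ha => /(_ _ e2) ha; move/cvgrPdist_lt : hb => /(_ _ e2) hb.
  near=> n; apply: le_lt_trans (normc_le_ReIm _) _; rewrite !raddfB/= [ltRHS]splitr.
  by apply: ltrD; rewrite distrC; near: n.
split=> // n n0n.
have cn : normc (w k - w n) @[k --> \oo] --> normc ((a +i* b)%C - w n).
  exact: (cvgc_norm (cvgcB cw (cvg_cst (w n)))).
apply: (cvgr_to_le cn); exists n => // k /=.
suff : (n <= k)%N -> normc (w k - w n) <= s n - s k.
  by move=> /[apply] /le_trans; apply; rewrite gerBl.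
elim: k => [|k IH]; first by rewrite leqn0 => /eqP ->; rewrite !subrr normc0.
rewrite leq_eqVlt => /predU1P[<-|]; first by rewrite !subrr normc0.
rewrite ltnS => nk; have := IH nk; have := h _ (leq_trans n0n nk).
have := le_normcD (w k.+1 - w k) (w k - w n); rewrite addrA subrK; lra.
Unshelve. all: by end_near. Qed.

(** A non-negative sequence cannot lose d / (n + 1) at every step, since the
    harmonic series diverges. *)
Lemma harmonic_decrease (r : nat -> R) (d : R) n0 :
  0 < d -> (forall n, 0 <= r n) ->
  (forall n, (n0 <= n)%N -> r n.+1 <= r n - d / n.+1%:R) -> False.
Proof.
move=> d0 r0 h; apply: (@dvg_harmonic R).
pose u : nat -> R := series (@harmonic R).
have uS n : u n.+1 = u n + n.+1%:R^-1 by rewrite /u /series /= big_nat_recr.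
have h1 k : r (n0 + k)%N + d * (u (n0 + k)%N) <= r n0 + d * u n0.
  elim: k => [|k IH]; first by rewrite addn0.
  apply: le_trans IH; rewrite addnS uS mulrDr; have := h _ (leq_addr k n0); set v := (_.+1%:R)^-1; lra.
apply: nondecreasing_is_cvgn.
  apply/nondecreasing_seqP => n; rewrite -/u uS lerDl invr_ge0; exact: ler0n.
exists ((r n0 + d * u n0) / d) => _ [n _ <-]; rewrite -/u.
rewrite ler_pdivlMr// mulrC.
have mono : {homo u : a b / (a <= b)%N >-> a <= b}.
  by apply/nondecreasing_seqP => k; rewrite uS lerDl invr_ge0 ler0n.
have := h1 n; have := r0 (n0 + n)%N; have := mono _ _ (leq_addl n0 n).
move=> hu; have : d * u n <= d * u (n0 + n)%N by rewrite ler_pM2l.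
lra.
Qed.

(** Errors of size O(1 / m^2) are always written as C / (m (m + 1)), whose sums
    telescope. *)
Lemma inv_telescope (m : nat) (C : R) : (0 < m)%N ->
  C / (m%:R * m.+1%:R) = C / m%:R - C / m.+1%:R.
Proof.
move=> m0; have h1 : (m%:R : R) != 0 by rewrite pnatr_eq0 -lt0n.
have h2 : (m.+1%:R : R) != 0 by rewrite pnatr_eq0.
have h3 : (m.+1%:R : R) = m%:R + 1 by rewrite -natr1.
by rewrite h3 in h2 *; field; rewrite h1 h2.
Qed.

Section Perturbation.
Variables (P Q : nat -> R[i]) (rho : nat -> R) (C : R).
Hypothesis C0 : 0 <= C.
Hypothesis rho01 : forall m, (0 < m)%N -> rho m <= 1.
Hypothesis hP : forall m, (0 < m)%N ->
  normc (P m.+1 - P m) <= C / (m%:R * m.+1%:R) * (normc (P m) + normc (Q m)).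
Hypothesis hQ : forall m, (0 < m)%N ->
  normc (Q m.+1) <= rho m * normc (Q m) +
     C / (m%:R * m.+1%:R) * (normc (P m) + normc (Q m)).

Let e m := C / (m%:R * m.+1%:R) : R.
Let M m := normc (P m) + normc (Q m).

Let e_ge0 m : 0 <= e m.
Proof. by rewrite /e divr_ge0// mulr_ge0. Qed.

Let M_ge0 m : 0 <= M m. Proof. by rewrite /M addr_ge0 ?normc_ge0. Qed.

Let M_step m : (0 < m)%N -> M m.+1 <= (1 + 2 * e m) * M m.
Proof.
move=> m0; rewrite /M; have := hP m0; have := hQ m0; rewrite -/(e m) -/(M m).
have := le_normcD (P m.+1 - P m) (P m); rewrite subrK.
have : rho m * normc (Q m) <= normc (Q m).
  by rewrite -[leRHS]mul1r ler_wpM2r ?normc_ge0// rho01.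
rewrite /M; lra.
Qed.

Let M_bound m0 m : (0 < m0)%N -> 4 * C <= m0%:R -> (m0 <= m)%N ->
  M m <= M m0 * (1 + 4 * C / m0%:R - 4 * C / m%:R).
Proof.
move=> m00 hm0; have m0R : 0 < m0%:R :> R by rewrite ltr0n.
elim: m => [|m IH]; first by rewrite leqn0 => /eqP m0E; rewrite m0E in m00.
rewrite leq_eqVlt => /predU1P[<-|]; first by rewrite addrK mulr1.
rewrite ltnS => m0m; have m0' := leq_trans m00 m0m.
have mR : 0 < m%:R :> R by rewrite ltr0n.
apply: le_trans (M_step m0') _.
have := IH m0m; set t := 4 * C / m0%:R; set u := 4 * C / m%:R => hM.
have t1 : t <= 1 by rewrite /t ler_pdivrMr// mul1r.
have u0 : 0 <= u by rewrite /u divr_ge0// mulr_ge0.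
have ->  : 4 * C / m.+1%:R = u - 4 * e m.
  by rewrite /e (inv_telescope _ m0') /u; ring.
apply: le_trans (_ : (1 + 2 * e m) * (M m0 * (1 + t - u)) <= _).
  by rewrite ler_wpM2l// addr_ge0// mulr_ge0.
have -> : (1 + 2 * e m) * (M m0 * (1 + t - u)) = M m0 * ((1 + 2 * e m) * (1 + t - u)) by ring.
rewrite ler_wpM2l//; have := e_ge0 m; nra.
Qed.

Let M_bound2 m0 m : (0 < m0)%N -> 4 * C <= m0%:R -> (m0 <= m)%N -> M m <= 2 * M m0.
Proof.
move=> m00 hm0 m0m; apply: le_trans (M_bound m00 hm0 m0m) _.
rewrite mulrC ler_wpM2r//.
have : 4 * C / m0%:R <= 1 by rewrite ler_pdivrMr ?mul1r ?ltr0n.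
have : 0 <= 4 * C / m%:R by rewrite divr_ge0// mulr_ge0.
lra.
Qed.

(** P is the component along the growing direction, Q along the other one.
    Once C / m is at most 1/4 the total mass |P| + |Q| can at most double, so
    P moves by a summable amount.  The second conclusion shows that the limit
    is not 0 for a sequence that starts, late enough, with Q = 0. *)
Lemma perturbation_cvg m0 : (0 < m0)%N -> 4 * C <= m0%:R ->
  exists l : R[i], P @ \oo --> l /\ normc (l - P m0) <= (normc (P m0) + normc (Q m0)) / 2.
Proof.
move=> m00 hm0.
have [||l [cl hl]] := @telescope_cvg P (fun m => C * (2 * M m0) / m%:R) m0.
- by move=> m; rewrite divr_ge0// mulr_ge0// mulr_ge0.
- move=> m m0m; have m0' := leq_trans m00 m0m.
  apply: le_trans (hP m0') _; rewrite -/(M m) -inv_telescope//.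
  rewrite mulrAC ler_wpM2r ?invr_ge0 ?mulr_ge0// ler_wpM2l//.
  exact: M_bound2.
exists l; split=> //; apply: le_trans (hl _ (leqnn _)) _; rewrite -/(M m0).
rewrite ler_pdivrMr ?ltr0n//.
have := M_ge0 m0; have : M m0 * (4 * C) <= M m0 * m0%:R by rewrite ler_wpM2l.
lra.
Qed.

(** |Q_m| + K / m decreases, and if its limit were positive it would lose a
    fixed multiple of 1 / m at every step. *)
Lemma perturbation_decay (d : R) : 0 < d ->
  (forall m, (0 < m)%N -> rho m <= 1 - d / m.+1%:R) -> Q @ \oo --> (0 : R[i]).
Proof.
move=> d0 hrho.
have [m0 m00 hm0] : exists2 m0, (0 < m0)%N & 4 * C <= m0%:R.
  exists (Num.truncn (4 * C)).+1 => //; apply: ltW; exact: truncnS_gt.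
pose K := C * (2 * M m0).
have K0 : 0 <= K by rewrite mulr_ge0// mulr_ge0.
have q_step m : (m0 <= m)%N ->
   normc (Q m.+1) <= rho m * normc (Q m) + (K / m%:R - K / m.+1%:R).
  move=> m0m; have m0' := leq_trans m00 m0m.
  apply: le_trans (hQ m0') _; rewrite -inv_telescope// lerD2l -/(M m).
  rewrite mulrAC ler_wpM2r ?invr_ge0 ?mulr_ge0// ler_wpM2l//.
  exact: M_bound2.
pose r m := normc (Q m) + K / m%:R.
have r0 m : 0 <= r m by rewrite addr_ge0 ?normc_ge0// divr_ge0.
have r_step m : (m0 <= m)%N -> r m.+1 <= r m - d / m.+1%:R * normc (Q m).
  move=> m0m; have m0' := leq_trans m00 m0m.
  have := q_step _ m0m; rewrite /r.
  have : rho m * normc (Q m) <= (1 - d / m.+1%:R) * normc (Q m).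
    by rewrite ler_wpM2r ?normc_ge0// hrho.
  set v := d / _; set k1 := K / m%:R; set k2 := K / _; lra.
have r_noninc m k : (m0 <= m)%N -> r (m + k)%N <= r m.
  move=> m0m; elim: k => [|k IH]; first by rewrite addn0.
  rewrite addnS; apply: le_trans IH.
  apply: le_trans (r_step _ (leq_trans m0m (leq_addr _ _))) _.
  by rewrite gerBl mulr_ge0 ?normc_ge0// divr_ge0// ltW.
apply/cvgcP => eps eps0.
have e2 : 0 < eps / 2 by rewrite divr_gt0.
have [[m1 m0m1 hm1]|nex] := pselect (exists2 m, (m0 <= m)%N & r m < eps).
  exists m1 => // m /= m1m; rewrite subr0.
  apply: le_lt_trans hm1; rewrite -(subnKC m1m).
  apply: (le_trans _ (r_noninc m1 (m - m1)%N m0m1)); rewrite /r lerDl divr_ge0//.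
exfalso.
have hr m : (m0 <= m)%N -> eps <= r m.
  by move=> m0m; rewrite leNgt; apply/negP => hh; apply: nex; exists m.
(* Beyond m1 the error K / m is below eps / 2, so |Q_m| >= eps / 2. *)
pose m1 := (m0 + (Num.truncn (K / (eps / 2))).+1)%N.
apply: (@harmonic_decrease r (d * (eps / 2)) m1) => //; first by rewrite mulr_gt0.
move=> m m1m; have m0m : (m0 <= m)%N by apply: leq_trans m1m; rewrite leq_addr.
have m0' := leq_trans m00 m0m.
apply: le_trans (r_step _ m0m) _.
rewrite lerD2l lerN2 mulrAC ler_wpM2l ?divr_ge0 ?ltW//.
have : K / m%:R < eps / 2.
  rewrite ltr_pdivrMr ?ltr0n// mulrC -ltr_pdivrMr//.
  apply: lt_le_trans (truncnS_gt _) _; rewrite ler_nat.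
  by apply: leq_trans m1m; rewrite leq_addl.
have := hr _ m0m; rewrite /r; lra.
Qed.

End Perturbation.
End Sequences.

(** * Estimates for the complex exponential *)

Section TrigBounds.
Context {R : realType}.
Implicit Types a b : R.

(** The mean value theorem on the segment from 0 to b, for b of any sign. *)
Lemma MVT_bound (f df : R -> R) (b : R) :
  (forall y : R, is_derive y (1 : R) f (df y)) ->
  exists2 c, `|c| <= `|b| & f b - f 0 = df c * b.
Proof.
move=> hf.
have cf (u v : R) : {within `[u, v], continuous f}.
  apply: continuous_subspaceT => y; apply: differentiable_continuous.
  by apply/derivable1_diffP; exact: ex_derive.
have [b0|b0] := leP 0 b.
  have [c] := MVT_segment b0 (fun y _ => hf y) (cf _ _).
  rewrite subr0 in_itv/= => /andP[c0 cb] ->; exists c => //.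
  by rewrite !ger0_norm.
have [c] := MVT_segment (ltW b0) (fun y _ => hf y) (cf _ _).
rewrite in_itv/= => /andP[c0 cb] h; exists c.
  by rewrite !ler0_norm ?lerN2// ltW.
lra.
Qed.

Lemma sin_bound b : `|sin b| <= `|b|.
Proof.
have [c _] := @MVT_bound sin cos b (fun y => is_derive_sin y).
rewrite sin0 subr0 => ->; rewrite normrM ler_piMl//; exact: cos_max.
Qed.

Lemma cos_bound b : `|cos b - 1| <= b ^+ 2.
Proof.
have [c cb] := @MVT_bound cos (fun y => - sin y) b (fun y => is_derive_cos y).
rewrite cos0 => ->; rewrite normrM normrN -(real_normK (num_real b)) expr2.
by rewrite ler_wpM2r// (le_trans (sin_bound _)).
Qed.

Lemma cos_bound1 b : `|cos b - 1| <= `|b|.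
Proof.
have [c cb] := @MVT_bound cos (fun y => - sin y) b (fun y => is_derive_cos y).
by rewrite cos0 => ->; rewrite normrM normrN ler_piMl// sin_max.
Qed.

Lemma sin_bound2 b : `|sin b - b| <= b ^+ 2.
Proof.
have h y : is_derive y (1 : R) (fun u => sin u - u) (cos y - 1) by exact: is_deriveB.
have [c cb] := @MVT_bound _ _ b h.
rewrite sin0 !subr0 => ->; rewrite normrM -(real_normK (num_real b)) expr2.
by rewrite ler_wpM2r// (le_trans (cos_bound1 _)).
Qed.

Lemma expR_bound a : `|a| <= 1 / 2 -> `|expR a - 1 - a| <= 2 * a ^+ 2.
Proof.
rewrite ler_norml => /andP[a1 a2].
have h1 := expR_ge1Dx a; have h2 := expR_ge1Dx (- a).
have h3 : expR a * expR (- a) = 1 by rewrite -expRD subrr expR0.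
have h4 : 0 < expR a by exact: expR_gt0.
have h5 : expR a * (1 - a) <= 1.
  by have := ler_wpM2l (ltW h4) h2; rewrite h3.
have h6 : expR a <= 1 + a + 2 * a ^+ 2.
  have h7 : expR a * (1 - a) <= (1 + a + 2 * a ^+ 2) * (1 - a).
    apply: (le_trans h5); nra.
  have a3 : 0 < 1 - a by lra.
  by rewrite ler_pM2r in h7.
rewrite ger0_norm; lra.
Qed.

End TrigBounds.

Section Cexp.
Context {R : realType}.
Implicit Types z w : R[i].

Definition cexp z : R[i] :=
  (expR (complex.Re z))%:C%C * (cos (complex.Im z) +i* sin (complex.Im z))%C.

Lemma cexpD z w : cexp (z + w) = cexp z * cexp w.
Proof.
case: z w => a b [c d]; rewrite /cexp /= expRD cosD sinD.
by simpc; congr (_ +i* _)%C; ring.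
Qed.

Lemma cexp_neq0 z : cexp z != 0.
Proof.
rewrite /cexp mulf_neq0//; first by rewrite eq_complex/= negb_and gt_eqF// expR_gt0.
apply/negP; rewrite eq_complex/= => /andP[/eqP h1 /eqP h2].
by have := cos2Dsin2 (complex.Im z); rewrite h1 h2 expr0n/= addr0 => /eqP; rewrite eq_sym oner_eq0.
Qed.

Lemma cexp_bound z : normc z <= 1 / 2 -> normc (cexp z - 1 - z) <= 8 * normc z ^+ 2.
Proof.
move=> hz; have ha := le_trans (Re_le_normc z) hz; have hb := le_trans (Im_le_normc z) hz.
have sa : complex.Re z ^+ 2 <= normc z ^+ 2.
  by rewrite -(real_normK (num_real (complex.Re z))) lerXn2r ?nnegrE ?normc_ge0// Re_le_normc.
have sb : complex.Im z ^+ 2 <= normc z ^+ 2.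
  by rewrite -(real_normK (num_real (complex.Im z))) lerXn2r ?nnegrE ?normc_ge0// Im_le_normc.
move: (normc z) hz ha hb sa sb => N; case: z => a b hN; set X := normc _; rewrite /= => ha hb sa sb.
have E : cexp (a +i* b)%C - 1 - (a +i* b)%C =
   ((expR a - 1 - a + expR a * (cos b - 1)) +i* (expR a * (sin b - b) + (expR a - 1) * b))%C.
  by rewrite /cexp /=; simpc; congr (_ +i* _)%C; ring.
rewrite /X E; apply: le_trans (normc_le_ReIm _) _ => /=.
have e1 := expR_bound ha.
have e2 : expR a <= 2.
  move: e1 ha; rewrite !ler_norml => /andP[_ e1] /andP[h1 h2]; nra.
have e0 := expR_gt0 a.
have e3 : `|expR a - 1| <= 2 * `|a|.
  have -> : expR a - 1 = (expR a - 1 - a) + a by ring.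
  apply: le_trans (ler_normD _ _) _.
  have : a ^+ 2 <= `|a| / 2 by rewrite -(real_normK (num_real a)) expr2 ler_wpM2l//; lra.
  lra.
have c1 := cos_bound b; have s1 := sin_bound2 b.
have t1 : `|expR a - 1 - a + expR a * (cos b - 1)| <= 2 * a ^+ 2 + 2 * b ^+ 2.
  apply: le_trans (ler_normD _ _) _; apply: lerD => //.
  rewrite normrM (ger0_norm (ltW e0)); apply: ler_pM => //; exact: ltW.
have t2 : `|expR a * (sin b - b) + (expR a - 1) * b| <= 2 * b ^+ 2 + 2 * `|a| * `|b|.
  apply: le_trans (ler_normD _ _) _; apply: lerD => //.
    rewrite normrM (ger0_norm (ltW e0)); apply: ler_pM => //; exact: ltW.
  by rewrite normrM ler_wpM2r.
have t3 : 2 * `|a| * `|b| <= a ^+ 2 + b ^+ 2.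
  rewrite -(real_normK (num_real a)) -(real_normK (num_real b)).
  have := sqr_ge0 (`|a| - `|b|); nra.
lra.
Qed.

Lemma nat_cpowE n z : nat_cpow n z = cexp (z * (ln (n%:R : R))%:C%C).
Proof. by case: z => a b; rewrite /nat_cpow /cexp; simpc. Qed.

Lemma nat_cpowD n z w : nat_cpow n (z + w) = nat_cpow n z * nat_cpow n w.
Proof. by rewrite !nat_cpowE mulrDl cexpD. Qed.

Lemma nat_cpow_neq0 n z : nat_cpow n z != 0.
Proof. by rewrite nat_cpowE cexp_neq0. Qed.

Lemma nat_cpow_nat n k : (0 < n)%N -> nat_cpow n (k%:R : R[i]) = n%:R ^+ k.
Proof.
move=> n0; elim: k => [|k IH].
  by rewrite nat_cpowE mul0r expr0 /cexp /= expR0 cos0 sin0; simpc.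
rewrite -natr1 nat_cpowD IH exprSr; congr (_ * _).
rewrite nat_cpowE mul1r /cexp /= lnK ?posrE ?ltr0n// cos0 sin0.
by rewrite complexr0 mulr1 rmorph_nat.
Qed.

End Cexp.

(** * Euler's limit for the Gamma function *)

Section BoundAll.
Context {R : realType}.

(** A larger constant absorbs finitely many indices, provided that the weight
    is positive; so bounds valid for large m may be assumed from m = 1 on. *)
Lemma eventually_bound_all (f : nat -> R) (C : R) n0 :
  (forall m, (n0 <= m)%N -> (0 < m)%N -> f m <= C / (m%:R * m.+1%:R)) ->
  exists2 C' : R, 0 <= C' & forall m, (0 < m)%N -> f m <= C' / (m%:R * m.+1%:R).
Proof.
have wpos m (a b : R) : a <= b -> a / (m%:R * m.+1%:R) <= b / (m%:R * m.+1%:R).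
  by move=> ab; rewrite ler_wpM2r// invr_ge0 mulr_ge0.
elim: n0 C => [|n0 IH] C h.
  exists `|C| => // m m0; apply: le_trans (h _ _ m0) _ => //.
  by apply: wpos; exact: ler_norm.
apply: (IH (Num.max C (f n0 * (n0%:R * n0.+1%:R)))) => m.
rewrite leq_eqVlt => /predU1P[<- n00|n0m m0].
  rewrite ler_pdivlMr ?mulr_gt0 ?ltr0n//.
  by rewrite le_max lexx orbT.
by apply: le_trans (h _ n0m m0) _; apply: wpos; rewrite le_max lexx.
Qed.
End BoundAll.

Section GammaLimit.
Context {R : realType}.
Implicit Types z : R[i].

(** The sequence whose limit defines [Gamma]. *)
Definition euler z n : R[i] :=
  n`!%:R * nat_cpow n z / \prod_(0 <= k < n.+1) (z + k%:R).

Definition log_step n : R := ln n.+1%:R - ln n%:R.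

Lemma log_step_bounds n : (0 < n)%N -> 1 / n.+1%:R <= log_step n <= 1 / n%:R.
Proof.
move=> n0; have nR : 0 < n%:R :> R by rewrite ltr0n.
have n1R : 0 < n.+1%:R :> R by rewrite ltr0n.
have e : n.+1%:R = n%:R + 1 :> R by rewrite natr1.
apply/andP; split; rewrite /log_step.
  have := expR_ge1Dx (ln n%:R - ln n.+1%:R : R).
  rewrite expRD expRN !lnK ?posrE// => h.
  have : n%:R / n.+1%:R = 1 - 1 / n.+1%:R :> R.
    by rewrite e; field; rewrite -e gt_eqF.
  move=> E; move: h; rewrite E; move: (1 / n.+1%:R) (ln n%:R) (ln n.+1%:R) => u v w; lra.
have := expR_ge1Dx (ln n.+1%:R - ln n%:R : R).
rewrite expRD expRN !lnK ?posrE// => h.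
have : n.+1%:R / n%:R = 1 + 1 / n%:R :> R.
  by rewrite e; field; rewrite gt_eqF.
move=> E; move: h; rewrite E; move: (1 / n%:R) (ln n%:R) (ln n.+1%:R) => u v w; lra.
Qed.

Definition euler_ratio z n : R[i] :=
  n.+1%:R / (z + n.+1%:R) * cexp (z * (log_step n)%:C%C).

Lemma eulerS z n : euler z n.+1 = euler z n * euler_ratio z n.
Proof.
rewrite /euler /euler_ratio big_nat_recr//= factS natrM.
have -> : nat_cpow n.+1 z = nat_cpow n z * cexp (z * (log_step n)%:C%C).
  rewrite !nat_cpowE -cexpD -mulrDr -rmorphD; congr (cexp (z * _%:C%C)).
  by rewrite /log_step addrC subrK.
rewrite invfM; ring.
Qed.

Lemma euler_neq0 z n : (forall k : nat, z <> - k%:R) -> euler z n != 0.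
Proof.
move=> hz; have f0 : n`!%:R != 0 :> R[i] by rewrite pnatr_eq0 -lt0n fact_gt0.
apply: mulf_neq0; first by rewrite mulf_neq0// nat_cpow_neq0.
rewrite invr_eq0 prodf_seq_neq0; apply/allP => k _ /=.
by rewrite addr_eq0; apply/eqP; exact: hz.
Qed.

(** With N = n + 1 and t = ln N - ln n, the ratio minus 1 is
    (N (e^(zt) - 1 - zt) + z (N t - 1)) / (z + N); both terms of the numerator
    are O(1 / n) because 1 / N <= t <= 1 / n. *)
Lemma euler_ratio_bound z n : (0 < n)%N -> 2 * normc z <= n%:R ->
  normc (euler_ratio z n - 1) <= (32 * normc z ^+ 2 + 2 * normc z) / (n%:R * n.+1%:R).
Proof.
move=> n0 hn; have nR : 0 < n%:R :> R by rewrite ltr0n.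
have n1 : 1 <= n%:R :> R by rewrite ler1n.
have e : n.+1%:R = n%:R + 1 :> R by rewrite natr1.
have /andP[t1 t2] := log_step_bounds n0.
have [t ht] : exists t, log_step n = t by exists (log_step n).
rewrite ht in t1 t2.
have N0 : 0 < n.+1%:R :> R by rewrite ltr0n.
have t0 : 0 < t by apply: lt_le_trans t1; rewrite divr_gt0.
set Z := normc z in hn *; have Z0 : 0 <= Z by exact: normc_ge0.
have tZ : normc (z * t%:C%C) = Z * t by rewrite normcM normc_real gtr0_norm.
have zt : Z * t <= Z / n%:R by rewrite ler_wpM2l// -[n%:R^-1]mul1r.
have zt2 : Z * t <= 1 / 2.
  apply: le_trans zt _; rewrite ler_pdivrMr//; lra.
have hE := @cexp_bound _ (z * t%:C%C); rewrite tZ in hE; move: (hE zt2) => {}hE.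
set E := cexp _ in hE.
have D0 : n.+1%:R / 2 <= normc (z + n.+1%:R).
  have := le_normcB (n.+1%:R : R[i]) (- z); rewrite opprK normcN normc_nat [n.+1%:R + z]addrC -/Z.
  rewrite e; lra.
have D1 : 0 < normc (z + n.+1%:R) by apply: lt_le_trans D0; rewrite divr_gt0.
have Dn : z + n.+1%:R != 0 by rewrite -normc_gt0.
have eq1 : euler_ratio z n - 1 =
  (n.+1%:R * (E - 1 - z * t%:C%C) + z * (n.+1%:R * t - 1)%:C%C) / (z + n.+1%:R).
  rewrite /euler_ratio ht -/E.
  have -> : ((n.+1%:R * t - 1)%:C%C : R[i]) = n.+1%:R * t%:C%C - 1.
    by rewrite rmorphB rmorphM rmorph1 rmorph_nat.
  by field; rewrite [1 + _]addrC natr1.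
rewrite eq1 normcM normcV ler_pdivrMr//.
have b2 : `|n.+1%:R * t - 1| <= 1 / n%:R.
  have h1 : 1 <= n.+1%:R * t by rewrite mulrC -ler_pdivrMr.
  have h2 : n.+1%:R * t <= 1 + 1 / n%:R.
    have -> : 1 + 1 / n%:R = n.+1%:R * (1 / n%:R) :> R by rewrite e; field; rewrite gt_eqF.
    by rewrite ler_pM2l.
  rewrite ger0_norm; lra.
have b1 : (Z * t) ^+ 2 <= Z ^+ 2 / n%:R ^+ 2.
  by rewrite -expr_div_n lerXn2r// ?nnegrE ?mulr_ge0 ?invr_ge0 ?(ltW t0).
apply: le_trans (le_normcD _ _) _; rewrite !normcM normc_nat normc_real -/Z.
apply: le_trans (_ : n.+1%:R * (8 * (Z ^+ 2 / n%:R ^+ 2)) + Z * (1 / n%:R) <= _).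
  apply: lerD; last by rewrite ler_wpM2l.
  rewrite ler_wpM2l//; apply: (le_trans hE); rewrite ler_wpM2l//.
apply: le_trans (_ : (32 * Z ^+ 2 + 2 * Z) / (n%:R * n.+1%:R) * (n.+1%:R / 2) <= _); last first.
  rewrite ler_wpM2l// mulr_ge0// ?invr_ge0 ?mulr_ge0//.
  by rewrite addr_ge0 ?mulr_ge0// exprn_ge0.
have -> : (32 * Z ^+ 2 + 2 * Z) / (n%:R * n.+1%:R) * (n.+1%:R / 2) =
   (n%:R * 16 * Z ^+ 2 + n%:R * Z) / n%:R ^+ 2 :> R.
  by rewrite e; field; rewrite -e !gt_eqF.
have -> : n.+1%:R * (8 * (Z ^+ 2 / n%:R ^+ 2)) + Z * (1 / n%:R) =
   (n.+1%:R * 8 * Z ^+ 2 + n%:R * Z) / n%:R ^+ 2 :> R.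
  by field; rewrite gt_eqF.
rewrite ler_wpM2r ?invr_ge0 ?exprn_ge0//; rewrite lerD2r ler_wpM2r ?exprn_ge0//.
rewrite e; lra.
Qed.

(** A product of factors 1 + O(1 / n^2), none of which is 0, converges to a
    non-zero limit. *)
Lemma euler_cvg z : (forall k : nat, z <> - k%:R) ->
  exists2 l : R[i], l != 0 & euler z @ \oo --> l.
Proof.
move=> hz.
have hb n : ((Num.truncn (2 * normc z)).+1 <= n)%N -> (0 < n)%N ->
    normc (euler_ratio z n - 1) <=
    (32 * normc z ^+ 2 + 2 * normc z) / (n%:R * n.+1%:R).
  move=> hn n0; apply: euler_ratio_bound => //; apply: ltW.
  by apply: lt_le_trans (truncnS_gt _) _; rewrite ler_nat.
have [C C0 hC] := eventually_bound_all hb.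
have hP m : (0 < m)%N -> normc (euler z m.+1 - euler z m) <=
   C / (m%:R * m.+1%:R) * (normc (euler z m) + normc (0 : R[i])).
  move=> m0; rewrite eulerS -[X in _ - X]mulr1 -mulrBr normcM mulrC normc0 addr0.
  by rewrite ler_wpM2r ?normc_ge0// hC.
have hQ m : (0 < m)%N -> normc (0 : R[i]) <= (fun=> 1) m * normc (0 : R[i]) +
   C / (m%:R * m.+1%:R) * (normc (euler z m) + normc (0 : R[i])).
  move=> m0; rewrite normc0 mulr0 add0r addr0 mulr_ge0 ?normc_ge0// divr_ge0// mulr_ge0//.
have m00 : (0 < (Num.truncn (4 * C)).+1)%N by [].
have [|l [cl hl]] := perturbation_cvg C0 (fun m _ => lexx 1) hP hQ m00.
  by apply: ltW; exact: truncnS_gt.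
exists l => //; apply/eqP => l0; move: hl; rewrite l0 sub0r normcN normc0 addr0.
set P := euler z _; have : 0 < normc P by rewrite normc_gt0 euler_neq0.
lra.
Qed.

Lemma Gamma_cvg z : (forall k : nat, z <> - k%:R) ->
  Gamma z != 0 /\ euler z @ \oo --> Gamma z.
Proof.
move=> /euler_cvg[l l0 cl]; suff -> : Gamma z = l by [].
by apply: cvg_lim cl; exact: hausdorffC.
Qed.

End GammaLimit.

(** * The Gamma quotient as an infinite product *)

Section GammaQuotientProduct.
Context {R : realType}.
Implicit Types alpha beta x z : R[i].

(** [quotient_num] and [quotient_den] are the factors in the functional
    equation num(x) G(x) = den(x) G(x + 2) of the Gamma quotient G. *)
Definition quotient_num alpha beta x : R[i] := (x + alpha) * (x - alpha - beta + 1) * (x + beta).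
Definition quotient_den alpha beta x : R[i] :=
  (x - alpha + 2) * (x + alpha + beta + 1) * (x - beta + 2).

(** None of the six Gamma functions has a pole at x ([regularP]). *)
Definition regular alpha beta x := forall k : nat,
  quotient_num alpha beta (x + 2 * k%:R) != 0 /\ quotient_den alpha beta (x + 2 * k%:R) != 0.

Lemma two_neq0 : (2 : R[i]) != 0.
Proof. by rewrite pnatr_eq0. Qed.

Lemma half_eqN (w : R[i]) k : (w / 2 = - k%:R) <-> (w + 2 * k%:R = 0).
Proof.
split=> [h|/eqP]; first by rewrite -[w](divfK two_neq0) h; ring.
by rewrite addr_eq0 => /eqP ->; field; rewrite ?two_neq0.
Qed.

Lemma regularP alpha beta x :
  (exists2 z, z \in Gamma_args_num alpha beta x ++ Gamma_args_den alpha beta x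
     & Gamma_pole z) <-> ~ regular alpha beta x.
Proof.
rewrite /Gamma_args_num /Gamma_args_den; split.
  move=> [z + [k zk]] hr; have [] := hr k; rewrite /quotient_num /quotient_den !mulf_eq0 !negb_or.
  move=> /andP[/andP[/eqP h1 /eqP h2] /eqP h3] /andP[/andP[/eqP h4 /eqP h5] /eqP h6].
  rewrite !inE; have E w : (z == w / 2) -> w + 2 * k%:R = 0.
    by move=> /eqP zw; apply/half_eqN; rewrite -zw.
  move=> /orP[/E h|/orP[/E h|/orP[/E h|/orP[/E h|/orP[/E h|/E h]]]]].
  - by apply: h1; rewrite -h; ring.
  - by apply: h2; rewrite -h; ring.
  - by apply: h3; rewrite -h; ring.
  - by apply: h4; rewrite -h; ring.
  - by apply: h5; rewrite -h; ring.
  - by apply: h6; rewrite -h; ring.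
move=> /existsNP[k] /not_andP[] /negP; rewrite negbK /quotient_num /quotient_den !mulf_eq0.
- move=> /orP[/orP[]|] /eqP h; [exists ((x + alpha) / 2)|exists ((x - alpha - beta + 1) / 2)|exists ((x + beta) / 2)];
    rewrite ?inE ?eqxx ?orbT//; exists k; apply/half_eqN; rewrite -h; ring.
- move=> /orP[/orP[]|] /eqP h; [exists ((x - alpha + 2) / 2)|exists ((x + alpha + beta + 1) / 2)|exists ((x - beta + 2) / 2)];
    rewrite ?inE ?eqxx ?orbT//; exists k; apply/half_eqN; rewrite -h; ring.
Qed.

Lemma Gamma_quotient_regular alpha beta x : regular alpha beta x ->
  Gamma_quotient alpha beta x = fin_pt (Gamma_quotient_fin alpha beta x).
Proof.
move=> hr; rewrite /Gamma_quotient; case: asboolP => // /regularP hn.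
by have := hn hr.
Qed.

Lemma Gamma_quotient_pole alpha beta x : ~ regular alpha beta x ->
  Gamma_quotient alpha beta x =
  lim (fin_pt (Gamma_quotient_fin alpha beta z) @[z --> x^']).
Proof.
by move=> hr; rewrite /Gamma_quotient; case: asboolP => // hn; have /regularP := hr.
Qed.

Definition quotient_prod alpha beta x n : R[i] :=
  \prod_(0 <= k < n) (quotient_den alpha beta (x + 2 * k%:R) / quotient_num alpha beta (x + 2 * k%:R)).

(** The powers of n do not cancel: the arguments in the denominator add up to
    2 more than those in the numerator, which leaves n^2. *)
Lemma euler_quotient alpha beta x n : (0 < n)%N ->
  euler ((x + alpha) / 2) n * (euler ((x - alpha - beta + 1) / 2) n * euler ((x + beta) / 2) n) /
  (euler ((x - alpha + 2) / 2) n * (euler ((x + alpha + beta + 1) / 2) n * euler ((x - beta + 2) / 2) n))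
  = quotient_prod alpha beta x n.+1 / n%:R ^+ 2.
Proof.
move=> n0; rewrite /euler.
have f0 : n`!%:R != 0 :> R[i] by rewrite pnatr_eq0 -lt0n fact_gt0.
have nn0 : n%:R != 0 :> R[i] by rewrite pnatr_eq0 -lt0n.
have hw : nat_cpow n ((x - alpha + 2) / 2) *
   (nat_cpow n ((x + alpha + beta + 1) / 2) * nat_cpow n ((x - beta + 2) / 2)) =
   nat_cpow n ((x + alpha) / 2) * (nat_cpow n ((x - alpha - beta + 1) / 2) *
    nat_cpow n ((x + beta) / 2)) * n%:R ^+ 2.
  rewrite -nat_cpow_nat// -!nat_cpowD; congr nat_cpow.
  by field; rewrite ?two_neq0.
have p1 := nat_cpow_neq0 n ((x + alpha) / 2).
have p2 := nat_cpow_neq0 n ((x - alpha - beta + 1) / 2).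
have p3 := nat_cpow_neq0 n ((x + beta) / 2).
have q1 := nat_cpow_neq0 n ((x - alpha + 2) / 2).
have q2 := nat_cpow_neq0 n ((x + alpha + beta + 1) / 2).
have q3 := nat_cpow_neq0 n ((x - beta + 2) / 2).
set a1 := nat_cpow n ((x + alpha) / 2) in p1 hw *.
set a2 := nat_cpow n ((x - alpha - beta + 1) / 2) in p2 hw *.
set a3 := nat_cpow n ((x + beta) / 2) in p3 hw *.
set b1 := nat_cpow n ((x - alpha + 2) / 2) in q1 hw *.
set b2 := nat_cpow n ((x + alpha + beta + 1) / 2) in q2 hw *.
set b3 := nat_cpow n ((x - beta + 2) / 2) in q3 hw *.
clearbody a1 a2 a3 b1 b2 b3.
have -> : quotient_prod alpha beta x n.+1 =
  (\prod_(0 <= k < n.+1) ((x - alpha + 2) / 2 + k%:R) *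
   (\prod_(0 <= k < n.+1) ((x + alpha + beta + 1) / 2 + k%:R) *
   \prod_(0 <= k < n.+1) ((x - beta + 2) / 2 + k%:R))) /
  (\prod_(0 <= k < n.+1) ((x + alpha) / 2 + k%:R) *
   (\prod_(0 <= k < n.+1) ((x - alpha - beta + 1) / 2 + k%:R) *
   \prod_(0 <= k < n.+1) ((x + beta) / 2 + k%:R))).
  rewrite -!big_split -prodf_div; apply: eq_bigr => k _ /=.
  have -> : quotient_den alpha beta (x + 2 * k%:R) = 8 * (((x - alpha + 2) / 2 + k%:R) *
     (((x + alpha + beta + 1) / 2 + k%:R) * ((x - beta + 2) / 2 + k%:R))).
    by rewrite /quotient_den; field; rewrite ?two_neq0.
  have -> : quotient_num alpha beta (x + 2 * k%:R) = 8 * (((x + alpha) / 2 + k%:R) *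
     (((x - alpha - beta + 1) / 2 + k%:R) * ((x + beta) / 2 + k%:R))).
    by rewrite /quotient_num; field; rewrite ?two_neq0.
  by rewrite -mulf_div divff ?mul1r// pnatr_eq0.
set d1 := \prod_(0 <= k < n.+1) ((x - alpha + 2) / 2 + k%:R).
set d2 := \prod_(0 <= k < n.+1) ((x + alpha + beta + 1) / 2 + k%:R).
set d3 := \prod_(0 <= k < n.+1) ((x - beta + 2) / 2 + k%:R).
set c1 := \prod_(0 <= k < n.+1) ((x + alpha) / 2 + k%:R).
set c2 := \prod_(0 <= k < n.+1) ((x - alpha - beta + 1) / 2 + k%:R).
set c3 := \prod_(0 <= k < n.+1) ((x + beta) / 2 + k%:R).
set f := n`!%:R in f0 *.
transitivity ((f ^+ 3 / f ^+ 3) * ((a1 * (a2 * a3)) / (b1 * (b2 * b3))) * ((d1 * (d2 * d3)) / (c1 * (c2 * c3)))).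
  by rewrite !invfM !invrK; ring.
rewrite divff ?expf_neq0// mul1r hw.
set a := a1 * (a2 * a3); have a0 : a != 0 by rewrite /a !mulf_neq0.
by rewrite invfM [a * _]mulrA divff// mul1r mulrC.
Qed.

Lemma quotient_prod_cvg alpha beta x : regular alpha beta x ->
  quotient_prod alpha beta x n.+1 / n%:R ^+ 2 @[n --> \oo] --> Gamma_quotient_fin alpha beta x.
Proof.
move=> hr.
have G (w : R[i]) : (forall k : nat, w + 2 * k%:R <> 0) -> Gamma (w / 2) != 0 /\ euler (w / 2) @ \oo --> Gamma (w / 2).
  by move=> h; apply: Gamma_cvg => k hk; apply: (h k); exact: ((half_eqN w k).1 hk).
have F k : [/\ x + alpha + 2 * k%:R <> 0, x - alpha - beta + 1 + 2 * k%:R <> 0,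
   x + beta + 2 * k%:R <> 0, x - alpha + 2 + 2 * k%:R <> 0 &
   x + alpha + beta + 1 + 2 * k%:R <> 0 /\ x - beta + 2 + 2 * k%:R <> 0].
  have [] := hr k; rewrite /quotient_num /quotient_den !mulf_eq0 !negb_or.
  move=> /andP[/andP[/eqP h1 /eqP h2] /eqP h3] /andP[/andP[/eqP h4 /eqP h5] /eqP h6].
  split; last split.
  - by apply: contra_not h1 => <-; ring.
  - by apply: contra_not h2 => <-; ring.
  - by apply: contra_not h3 => <-; ring.
  - by apply: contra_not h4 => <-; ring.
  - by apply: contra_not h5 => <-; ring.
  - by apply: contra_not h6 => <-; ring.
have [|G1 c1] := G (x + alpha); first by move=> k; have [] := F k.
have [|G2 c2] := G (x - alpha - beta + 1); first by move=> k; have [] := F k.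
have [|G3 c3] := G (x + beta); first by move=> k; have [] := F k.
have [|G4 c4] := G (x - alpha + 2); first by move=> k; have [] := F k.
have [|G5 c5] := G (x + alpha + beta + 1); first by move=> k; have [_ _ _ _ []] := F k.
have [|G6 c6] := G (x - beta + 2); first by move=> k; have [_ _ _ _ []] := F k.
have N0 : Gamma ((x - alpha + 2) / 2) * (Gamma ((x + alpha + beta + 1) / 2) * Gamma ((x - beta + 2) / 2)) != 0.
  by rewrite !mulf_neq0.
have c : euler ((x + alpha) / 2) n * (euler ((x - alpha - beta + 1) / 2) n * euler ((x + beta) / 2) n) /
  (euler ((x - alpha + 2) / 2) n * (euler ((x + alpha + beta + 1) / 2) n * euler ((x - beta + 2) / 2) n))
  @[n --> \oo] --> Gamma_quotient_fin alpha beta x.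
  rewrite /Gamma_quotient_fin /Gamma_args_num /Gamma_args_den !big_cons !big_nil !mulr1.
  exact: (cvgcM (cvgcM c1 (cvgcM c2 c3)) (cvgcV N0 (cvgcM c4 (cvgcM c5 c6)))).
apply: cvg_trans c; apply: near_eq_cvg; exists 1%N => // n /= n0.
by rewrite euler_quotient.
Qed.

End GammaQuotientProduct.

(** * Continued fractions and three-term recurrences *)

Section ThreeTerm.
Context {R : realType}.
Implicit Types (a b : nat -> R[i]) (u v : R[i]).

(** The state (y_(n-1), y_n) of the recurrence y_n = b_n y_(n-1) + a_n y_(n-2)
    started from y_(-1) = u and y_0 = v.  Numerators of the approximants are
    the solution with (u, v) = (1, b0), denominators that with (0, 1). *)
Fixpoint cf_sol a b u v n : R[i] * R[i] :=
  if n is n'.+1 then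
    let p := cf_sol a b u v n' in (p.2, b n * p.2 + a n * p.1)
  else (u, v).

Lemma cf_solS a b u v n :
  cf_sol a b u v n.+1 = ((cf_sol a b u v n).2, b n.+1 * (cf_sol a b u v n).2 + a n.+1 * (cf_sol a b u v n).1).
Proof. by []. Qed.

Lemma cf_sol_linear a b c c' u v u' v' n :
  cf_sol a b (c * u + c' * u') (c * v + c' * v') n =
  (c * (cf_sol a b u v n).1 + c' * (cf_sol a b u' v' n).1,
   c * (cf_sol a b u v n).2 + c' * (cf_sol a b u' v' n).2).
Proof. by elim: n => [//|n IH]; rewrite !cf_solS IH /=; congr (_, _); ring. Qed.

(** Homogeneous coordinates of a segment of the fraction, computed from its end
    backwards as the segments themselves are. *)
Fixpoint tail_pair a b m n : R[i] * R[i] :=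
  if n is n'.+1 then
    let p := tail_pair a b m.+1 n' in (a m * p.2, b m * p.2 + p.1)
  else (0, 1).

(** The passage between the backward evaluation of a fraction and the forward
    recurrence: the last value of a solution is a linear form in an earlier
    state, with the tail as coefficients. *)
Lemma cf_sol_tail a b u v m n :
  (cf_sol a b u v (m + n)).2 =
  (tail_pair a b m.+1 n).2 * (cf_sol a b u v m).2 + (tail_pair a b m.+1 n).1 * (cf_sol a b u v m).1.
Proof.
elim: n m => [|n IH] m; first by rewrite addn0 /= mul1r mul0r addr0.
by rewrite addnS -addSn IH /=; ring.
Qed.

Lemma sph_add_ratio (b0 : R[i]) u v : sph_add b0 (ratio_pt u v) = ratio_pt (b0 * v + u) v.
Proof.
rewrite /ratio_pt; case: eqP => //= /eqP v0; congr (Some _).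
by rewrite mulrDl mulfK.
Qed.

Lemma sph_div_ratio c u v : c != 0 -> (u != 0) || (v != 0) ->
  sph_div c (ratio_pt u v) = ratio_pt (c * v) u.
Proof.
move=> c0 uv; rewrite /sph_div (negPf c0) /ratio_pt.
have [v0|v0] := eqVneq v 0.
  move: uv; rewrite v0 eqxx orbF => u0.
  by rewrite (negPf u0) mulr0 mul0r.
rewrite /= mulf_eq0 invr_eq0 (negPf v0) orbF; case: eqP => // _.
by rewrite invfM invrK mulrCA mulrC [c * v]mulrC.
Qed.

Lemma cf_segment_tail a b m n :
  (forall k, (k < n)%N -> a (m + k)%N != 0) ->
  cf_segment a b m n = ratio_pt (tail_pair a b m n).1 (tail_pair a b m n).2 /\
  ((tail_pair a b m n).1 != 0) || ((tail_pair a b m n).2 != 0).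
Proof.
elim: n m => [|n IH] m ha.
  by rewrite /= /ratio_pt oner_eq0 mul0r orbT.
have am : a m != 0 by rewrite -[m]addn0 ha.
have [|e nz] := IH m.+1; first by move=> k kn; rewrite addSnnS ha.
rewrite /= e sph_add_ratio sph_div_ratio//; last first.
  have [h2|h2] := eqVneq (tail_pair a b m.+1 n).2 0; last by rewrite ?h2 ?orbT.
  by move: nz; rewrite h2 eqxx orbF mulr0 add0r => ->.
split=> //; rewrite mulf_eq0 (negPf am)/=.
have [h2|h2] := eqVneq (tail_pair a b m.+1 n).2 0; last by rewrite ?h2 ?orbT.
by move: nz; rewrite h2 eqxx orbF mulr0 add0r => ->.
Qed.

Lemma cf_approximant_sol a b (b0 : R[i]) n : (forall k, (0 < k <= n)%N -> a k != 0) ->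
  cf_approximant b0 a b n = ratio_pt (cf_sol a b 1 b0 n).2 (cf_sol a b 0 1 n).2 /\
  ((cf_sol a b 1 b0 n).2 != 0) || ((cf_sol a b 0 1 n).2 != 0).
Proof.
move=> ha; rewrite /cf_approximant.
have [|-> nz] := @cf_segment_tail a b 1 n.
  by move=> k kn; rewrite ha// add1n.
rewrite sph_add_ratio -[n in cf_sol _ _ _ _ n]add0n -[n in cf_sol _ _ 0 _ n]add0n !cf_sol_tail /=.
rewrite !mulr1 mulr0 addr0 mulrC; split=> //.
have [h2|h2] := eqVneq (tail_pair a b 1 n).2 0; last by rewrite orbT.
by move: nz; rewrite h2 eqxx orbF mul0r add0r => ->.
Qed.

Lemma cf_segment_terminates a b m k n : a (m + k)%N = 0 -> (k <= n)%N ->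
  cf_segment a b m n = cf_segment a b m k.
Proof.
elim: k m n => [|k IH] m n am kn.
  by case: n kn => //= n _; rewrite addn0 in am; rewrite /sph_div am eqxx.
case: n kn => // n kn /=; rewrite (IH m.+1 n)//.
by rewrite addSnnS.
Qed.

(** Nothing behind the first vanishing partial numerator is seen. *)
Lemma cf_terminates a b (b0 : R[i]) N : a N.+1 = 0 -> (forall k, (0 < k <= N)%N -> a k != 0) ->
  cf_approximant b0 a b n @[n --> \oo] --> ratio_pt (cf_sol a b 1 b0 N).2 (cf_sol a b 0 1 N).2.
Proof.
move=> aN ha; have [<- _] := @cf_approximant_sol a b b0 N ha.
apply: cvg_near_cst; exists N => // n /= Nn.
by rewrite /cf_approximant (@cf_segment_terminates a b 1 N n).
Qed.

End ThreeTerm.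

(** * The shift of x by 2 on solutions of the recurrence *)

Section ShiftMap.
Context {R : realType}.
Variables alpha beta : R[i].
Local Notation kap := (kappa alpha beta).
Local Notation lam := (lambda alpha beta).
Local Notation dp := (divergence_point alpha beta).

Lemma lambda_odd j x m : lam j x (2 * m).+1 = 1.
Proof. by rewrite /lambda oddS mul2n odd_double. Qed.

Lemma lambda_even j x m : lam j x (2 * m) = x ^+ 2 - dp j ^+ 2.
Proof.
by rewrite /lambda mul2n odd_double; case: j => [|[|[|j]]] //=; rewrite expr1n.
Qed.

(** With a = 1 - alpha - beta and u = 2 m + 1 the three families differ only in
    the signs of (a, alpha, beta) in (u + a)(u + alpha)(u + beta), and passing
    from odd to even index flips all three signs. *)
Definition kappa_odd_num j m : R[i] := let u : R[i] := 2 * m%:R + 1 in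
  match j with
  | 1 => (u + (1 - alpha - beta)) * (u + alpha) * (u + beta)
  | 2 => (u + (1 - alpha - beta)) * (u - alpha) * (u - beta)
  | _ => (u - (1 - alpha - beta)) * (u - alpha) * (u + beta)
  end.

Definition kappa_even_num j m : R[i] := let u : R[i] := 2 * m%:R + 1 in
  match j with
  | 1 => (u - (1 - alpha - beta)) * (u - alpha) * (u - beta)
  | 2 => (u - (1 - alpha - beta)) * (u + alpha) * (u + beta)
  | _ => (u + (1 - alpha - beta)) * (u + alpha) * (u - beta)
  end.

Lemma odd_neq0 m : (2 * m%:R + 1 : R[i]) != 0.
Proof. by rewrite -natrM natr1 pnatr_eq0. Qed.

Lemma kappa_oddE j m : kap j (2 * m).+1 = kappa_odd_num j m / (4 * (2 * m%:R + 1)).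
Proof.
rewrite /kappa oddS mul2n odd_double /= doubleK /kappa_odd /kappa_odd_num; cbv zeta; rewrite -[m.+1%:R]natr1.
have -> : 2 * (m%:R + 1) - 1 = 2 * m%:R + 1 :> R[i] by ring.
by congr (_ / _); case: j => [|[|[|j]]] /=; ring.
Qed.

Lemma kappa_evenE j m : kap j (2 * m).+2 = kappa_even_num j m / (4 * (2 * m%:R + 1)).
Proof.
rewrite /kappa !oddS mul2n odd_double /= doubleK /kappa_even /kappa_even_num; cbv zeta; rewrite -[m.+1%:R]natr1.
have -> : 2 * (m%:R + 1) - 1 = 2 * m%:R + 1 :> R[i] by ring.
by congr (_ / _); case: j => [|[|[|j]]] /=; ring.
Qed.

(** The recurrence of the j-th fraction observed every second step, where its
    coefficients are rational in m. *)
Definition kappa_sol j x u v m := cf_sol (kap j) (lam j x) u v (2 * m).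

Definition kappa_step j x m (p : R[i] * R[i]) : R[i] * R[i] :=
  let y1 := p.2 + kap j (2 * m).+1 * p.1 in
  (y1, (x ^+ 2 - dp j ^+ 2) * y1 + kap j (2 * m).+2 * p.2).

Lemma kappa_solS j x u v m : kappa_sol j x u v m.+1 = kappa_step j x m (kappa_sol j x u v m).
Proof.
rewrite /kappa_sol mulnS !addSn add0n !cf_solS lambda_odd mul1r.
have -> : (2 * m).+2 = (2 * m.+1)%N by rewrite mulnS.
by rewrite lambda_even mulnS.
Qed.

(** The matrix T_m(x) acting on states: T_0(x), transported along m steps of the
    recurrences at x and x + 2.  What singles it out is that its entries are
    polynomials in m, so that its effect for large m is visible.  Its determinant is
    num(x) den(x) for every m, because a step of the recurrence has a
    determinant that does not involve x. *)
Definition shift_map j x m (p : R[i] * R[i]) : R[i] * R[i] :=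
  let d := dp j in
  ((quotient_num alpha beta x + 4 * m%:R * (d ^+ 2 - x ^+ 2) + 8 * m%:R ^+ 2 * (x + d)) * p.1
     + 8 * m%:R * p.2,
   (x + d) * (x + 2 - d) * kappa_odd_num j m * p.1 +
   (quotient_den alpha beta x + 4 * m%:R * ((x + 2) ^+ 2 - d ^+ 2) + 8 * m%:R ^+ 2 * (x + 2 - d)) * p.2).

(** The bispectral identity: T intertwines the recurrences at x and x + 2. *)
Lemma shift_map_step j x m p : shift_map j x m.+1 (kappa_step j x m p) = kappa_step j (x + 2) m (shift_map j x m p).
Proof.
case: p => p q; have h := odd_neq0 m.
rewrite /kappa_step kappa_oddE kappa_evenE /shift_map /=.
congr (_, _); case: j => [|[|[|j]]] /=; rewrite /kappa_odd_num /kappa_even_num /quotient_num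
  /quotient_den -[m.+1%:R]natr1; field; rewrite ?h.
all: try done.
Qed.

Lemma shift_map_sol j x u v u' v' m : shift_map j x 0 (u, v) = (u', v') ->
  shift_map j x m (kappa_sol j x u v m) = kappa_sol j (x + 2) u' v' m.
Proof.
move=> h; elim: m => [|m IH]; first by rewrite /kappa_sol muln0.
by rewrite !kappa_solS shift_map_step IH.
Qed.

(** The leading term of the j-th fraction, lambda_0 / 2. *)
Definition kappa_b0 j x : R[i] := (x ^+ 2 - dp j ^+ 2) / 2.

(** The initial state of the numerators at x goes to num(x) times that at x + 2;
    [shift_map0_B] is the same for the denominators and den(x). *)
Lemma shift_map0_A j x : shift_map j x 0 (1, kappa_b0 j x) =
  (quotient_num alpha beta x * 1, quotient_num alpha beta x * kappa_b0 j (x + 2)).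
Proof.
rewrite /shift_map /kappa_b0 /quotient_num /quotient_den /kappa_odd_num /=.
by congr (_, _); case: j => [|[|[|j]]] /=; field.
Qed.

Lemma shift_map0_B j x : shift_map j x 0 (0, 1) = (quotient_den alpha beta x * 0, quotient_den alpha beta x * 1).
Proof. by rewrite /shift_map /=; congr (_, _); ring. Qed.

End ShiftMap.
Arguments kappa_sol : simpl never.

(** * Dominant solutions of a system of Euler type *)

Section Dominant.
Context {R : realType}.
Variables (x d : R[i]) (r1 r2 : nat -> R[i]) (K : R).
Hypothesis x0 : 0 < complex.Re x.
Hypothesis hr1 : forall m, normc (r1 m) <= K.
Hypothesis hr2 : forall m, normc (r2 m) <= K.

Let Y := x ^+ 2 - d ^+ 2.
Let k1 m := m%:R ^+ 2 + (1 / 2 + d) * m%:R + r1 m.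
Let k2 m := m%:R ^+ 2 + (3 / 2 - d) * m%:R + r2 m.

(** Behaves like m^(x + 1/2), the growing solution of the unperturbed system. *)
Definition growth m : R[i] := \prod_(1 <= k < m) ((k%:R + 1 / 2 + x) / k%:R).

(** Up to O(1 / m^2) the step from m to m + 1 is 1 + M / m with M of trace 1
    and determinant 1/4 - x^2: its eigenvalues are 1/2 + x and 1/2 - x. *)
Definition euler_system (c e : nat -> R[i]) := forall m, (0 < m)%N ->
  c m.+1 = k1 m / m%:R ^+ 2 * c m + e m / m%:R /\
  e m.+1 = Y / m.+1%:R * c m.+1 + k2 m / (m%:R * m.+1%:R) * e m.

Lemma Re_shift (a : R) : complex.Re (a%:C%C + x) = a + complex.Re x.
Proof. by rewrite raddfD. Qed.

Let nat_half m : (m%:R + 1 / 2 : R[i]) = (m%:R + 1 / 2 : R)%:C%C.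
Proof. by rewrite rmorphD rmorph_nat fmorph_div rmorph1 rmorph_nat. Qed.

(** Re x > 0 keeps the factors of [growth] away from 0. *)
Lemma normc_shift m : m%:R + 1 / 2 <= normc (m%:R + 1 / 2 + x).
Proof.
apply: le_trans (Re_le_normc _); rewrite nat_half Re_shift.
by rewrite ger0_norm ?addr_ge0 ?divr_ge0 ?(ltW x0)// lerDl ltW.
Qed.

Lemma shift_neq0 m : m%:R + 1 / 2 + x != 0.
Proof.
rewrite -normc_gt0; apply: lt_le_trans (normc_shift m).
by rewrite ltr_wpDl// divr_gt0.
Qed.

Lemma growthS m : (0 < m)%N -> growth m.+1 = growth m * ((m%:R + 1 / 2 + x) / m%:R).
Proof. by move=> m0; rewrite /growth big_nat_recr. Qed.

Lemma growth_neq0 m : growth m != 0.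
Proof.
elim: m => [|m IH]; first by rewrite /growth big_geq ?oner_neq0.
case: m IH => [|m] IH; first by rewrite /growth big_geq ?oner_neq0.
by rewrite growthS// !mulf_neq0 ?shift_neq0// invr_eq0 pnatr_eq0.
Qed.

Let damp m : R := normc ((m%:R + 1 / 2 - x) / (m%:R + 1 / 2 + x)).

(** Relative to the growing direction the other one is damped by
    |n - x| / |n + x| with n = m + 1/2; since |n + x|^2 - |n - x|^2 =
    4 n Re x, this is 1 minus a multiple of 1 / m. *)
Lemma damp_bound m : damp m <= 1 - complex.Re x / (1 + normc x) ^+ 2 / m.+1%:R.
Proof.
rewrite /damp normcM normcV.
set a := normc (_ - x); set b := normc (_ + x); set X := complex.Re x.
have b0 : 0 < b by rewrite normc_gt0 shift_neq0.
have a0 : 0 <= a by exact: normc_ge0.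
set n : R := m%:R + 1 / 2.
(* b - a is (b^2 - a^2) / (b + a), and b + a <= 2 b. *)
have ab : b ^+ 2 - a ^+ 2 = 4 * n * X.
  rewrite /a /b nat_half -/n /X; case: (x) => u v.
  rewrite /normc /= !sqr_sqrtr ?addr_ge0 ?sqr_ge0//; ring.
have N0 : 0 <= normc x by exact: normc_ge0.
have m1 : m.+1%:R = m%:R + 1 :> R by rewrite natr1.
have mge0 : 0 <= m%:R :> R by [].
have bn : b <= m.+1%:R * (1 + normc x).
  apply: le_trans (le_normcD _ _) _; rewrite nat_half normc_real ger0_norm; last by rewrite addr_ge0// divr_ge0.
  by rewrite m1; nra.
have M0 : 0 < m.+1%:R :> R by rewrite ltr0n.
have S0 : 0 < 1 + normc x by lra.
rewrite ler_pdivrMr//.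
set dl := X / _ / _.
have X0 : 0 < X by exact: x0.
have dl0 : 0 <= dl by rewrite /dl !divr_ge0 ?exprn_ge0 // ltW.
have dlb : dl * b ^+ 2 <= 2 * n * X.
  apply: le_trans (_ : dl * (m.+1%:R * (1 + normc x)) ^+ 2 <= _).
    by rewrite ler_wpM2l// lerXn2r// ?nnegrE ltW// mulr_gt0.
  have -> : dl * (m.+1%:R * (1 + normc x)) ^+ 2 = X * m.+1%:R.
    by rewrite /dl; field; rewrite !gt_eqF//= -?m1 ?[1 + _]addrC.
  by rewrite /n m1; nra.
have ba : a <= b.
  rewrite -(@ler_pXn2r _ 2)// ?nnegrE//; last exact: ltW.
  have : 0 <= 4 * n * X by rewrite !mulr_ge0// ?addr_ge0 ?divr_ge0// ltW.
  lra.
have h : (b - a) * (2 * b) >= 2 * (dl * b ^+ 2).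
  have : (b - a) * (b + a) <= (b - a) * (2 * b) by rewrite ler_wpM2l ?subr_ge0//; lra.
  have -> : (b - a) * (b + a) = b ^+ 2 - a ^+ 2 by ring.
  lra.
have : dl * b <= b - a.
  rewrite -(ler_pM2r b0); move: h; rewrite expr2; lra.
lra.
Qed.

Let KA := normc Y + (normc x + normc d) * (2 * K) + normc Y * (1 / 2 + normc d + K).
Let KB := K + 1 / 2 + normc d + normc Y.

Let K0 : 0 <= K. Proof. exact: le_trans (normc_ge0 _) (hr1 0). Qed.

Let x_neq0 : x != 0.
Proof. by apply: contraTneq x0 => ->; rewrite /= ltxx. Qed.

Let half_norm : normc (1 / 2 : R[i]) = 1 / 2 :> R.
Proof. by rewrite normcM normcV normc1 normc_nat. Qed.

Let CC := (KA + KB * (normc x + normc d)) / (2 * normc x).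

Let CC0 : 0 <= CC.
Proof.
by rewrite /CC /KA /KB !(divr_ge0, addr_ge0, mulr_ge0, normc_ge0).
Qed.

Section OneSolution.
Variables (c e : nat -> R[i]).
Hypothesis hce : euler_system c e.
Let P m := (e m + (x + d) * c m) / growth m.
Let Q m := ((x - d) * c m - e m) / growth m.
Let cN m := c m / growth m.
Let eN m := e m / growth m.

Let cNE m : cN m = (P m + Q m) / (2 * x).
Proof. by rewrite /cN /P /Q; field; rewrite growth_neq0 x_neq0. Qed.

Let eNE m : eN m = ((x - d) * P m - (x + d) * Q m) / (2 * x).
Proof. by rewrite /eN /P /Q; field; rewrite growth_neq0 x_neq0. Qed.

Let A m s : R[i] := - Y + (s * x + d) * r1 m * (m.+1%:R / m%:R) + Y * (1 / 2 + d + r1 m / m%:R).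
Let B m : R[i] := r2 m - 1 / 2 + d + Y.

Let stepP m : (0 < m)%N -> P m.+1 - P m =
  m%:R / (m%:R + 1 / 2 + x) * ((A m 1 * cN m + B m * eN m) / (m%:R * m.+1%:R)).
Proof.
move=> m0; have [hc he] := hce m0.
have mn : (m%:R : R[i]) != 0 by rewrite pnatr_eq0 -lt0n.
have mn1 : (m.+1%:R : R[i]) != 0 by rewrite pnatr_eq0.
rewrite /P /A /B /cN /eN growthS// he hc /k1 /k2 /Y.
have g0 := growth_neq0 m; have s0 := shift_neq0 m.
have e1 : m.+1%:R = m%:R + 1 :> R[i] by rewrite natr1.
rewrite e1 in mn1 *.
have s1 : m%:R * 2 + 1 + x * 2 != 0.
  have -> : m%:R * 2 + 1 + x * 2 = 2 * (m%:R + 1 / 2 + x) by field.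
  by rewrite mulf_neq0// pnatr_eq0.
by field; rewrite mn mn1 g0 s1.
Qed.

Let stepQ m : (0 < m)%N -> Q m.+1 =
  (m%:R + 1 / 2 - x) / (m%:R + 1 / 2 + x) * Q m -
  m%:R / (m%:R + 1 / 2 + x) * ((A m (-1) * cN m + B m * eN m) / (m%:R * m.+1%:R)).
Proof.
move=> m0; have [hc he] := hce m0.
have mn : (m%:R : R[i]) != 0 by rewrite pnatr_eq0 -lt0n.
have mn1 : (m.+1%:R : R[i]) != 0 by rewrite pnatr_eq0.
rewrite /Q /A /B /cN /eN growthS// he hc /k1 /k2 /Y.
have g0 := growth_neq0 m; have s0 := shift_neq0 m.
have e1 : m.+1%:R = m%:R + 1 :> R[i] by rewrite natr1.
rewrite e1 in mn1 *.
have s1 : m%:R * 2 + 1 + x * 2 != 0.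
  have -> : m%:R * 2 + 1 + x * 2 = 2 * (m%:R + 1 / 2 + x) by field.
  by rewrite mulf_neq0// pnatr_eq0.
by field; rewrite mn mn1 g0 s1.
Qed.

Let A_bound m s : (0 < m)%N -> normc s = 1 -> normc (A m s) <= KA.
Proof.
move=> m0 hs; have m1 : 1 <= m%:R :> R by rewrite ler1n.
have mR : 0 < m%:R :> R by rewrite ltr0n.
apply: le_trans (le_normcD _ _) _; rewrite normcM; apply: lerD.
  apply: le_trans (le_normcD _ _) _; rewrite normcN lerD2l !normcM normcV !normc_nat -mulrA.
  apply: ler_pM; rewrite ?normc_ge0 ?mulr_ge0 ?normc_ge0 ?invr_ge0//.
    by apply: le_trans (le_normcD _ _) _; rewrite normcM hs mul1r.
  rewrite mulrC; apply: ler_pM; rewrite ?mulr_ge0 ?normc_ge0 ?invr_ge0//.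
  by rewrite ler_pdivrMr// -natr1; lra.
rewrite ler_wpM2l ?normc_ge0//; apply: le_trans (le_normcD _ _) _; apply: lerD.
  by apply: le_trans (le_normcD _ _) _; rewrite half_norm.
rewrite normcM normcV normc_nat ler_pdivrMr//.
by apply: le_trans (hr1 m) _; rewrite ler_peMr.
Qed.

Let B_bound m : normc (B m) <= KB.
Proof.
rewrite /B /KB; apply: le_trans (le_normcD _ _) _; rewrite lerD2r.
apply: le_trans (le_normcD _ _) _; rewrite lerD2r.
by apply: le_trans (le_normcD _ _) _; rewrite normcN half_norm lerD2r.
Qed.

Let rem_bound m s : (0 < m)%N -> normc s = 1 ->
  normc (m%:R / (m%:R + 1 / 2 + x) * ((A m s * cN m + B m * eN m) / (m%:R * m.+1%:R)))
  <= CC / (m%:R * m.+1%:R) * (normc (P m) + normc (Q m)).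
Proof.
move=> m0 hs; have mR : 0 < m%:R :> R by rewrite ltr0n.
have f1 : normc (m%:R / (m%:R + 1 / 2 + x)) <= 1.
  rewrite normcM normcV normc_nat ler_pdivrMr ?normc_gt0 ?shift_neq0// [leRHS]mul1r.
  by apply: (le_trans _ (normc_shift m)); rewrite lerDl divr_ge0.
rewrite normcM; apply: le_trans (ler_piMl (normc_ge0 _) f1) _.
rewrite normcM normcV normcM !normc_nat [leRHS]mulrAC.
rewrite ler_wpM2r ?invr_ge0 ?mulr_ge0//.
have nx : 0 < normc x by rewrite normc_gt0 x_neq0.
set S := normc (P m) + normc (Q m).
have n2x : normc (2 * x) = 2 * normc x by rewrite normcM normc_nat.
have hc : normc (cN m) <= S / (2 * normc x).
  rewrite cNE normcM normcV n2x ler_wpM2r ?invr_ge0 ?mulr_ge0 ?normc_ge0//.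
  exact: le_normcD.
have he : normc (eN m) <= (normc x + normc d) * S / (2 * normc x).
  rewrite eNE normcM normcV n2x ler_wpM2r ?invr_ge0 ?mulr_ge0 ?normc_ge0//.
  apply: le_trans (le_normcD _ _) _; rewrite normcN (normcM (x - d)) (normcM (x + d)) /S mulrDr.
  apply: lerD; rewrite ler_wpM2r ?normc_ge0//.
    by apply: le_trans (le_normcD _ _) _; rewrite normcN.
  exact: le_normcD.
apply: le_trans (le_normcD _ _) _; rewrite (normcM (A m s)) (normcM (B m)).
apply: le_trans (_ : KA * (S / (2 * normc x)) + KB * ((normc x + normc d) * S / (2 * normc x)) <= _).
  by apply: lerD; apply: ler_pM; rewrite ?normc_ge0 ?A_bound ?B_bound.
by rewrite /CC le_eqVlt; apply/orP; left; apply/eqP; field; rewrite gt_eqF.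
Qed.

(** In the eigenvector coordinates P = e + (x + d) c and Q = (x - d) c - e the
    system is diagonal up to O(1 / m^2), and divided by [growth] it is covered
    by the lemmas on summable perturbations.  As Q tends to 0, e follows
    (x - d) c. *)
Lemma dominant_limit m0 : (0 < m0)%N -> 4 * CC <= m0%:R ->
  exists l : R[i], [/\ c m / growth m @[m --> \oo] --> l,
     e m / growth m @[m --> \oo] --> (x - d) * l &
     e m0 = (x - d) * c m0 -> c m0 != 0 -> l != 0].
Proof.
move=> m00 hm0.
have n1 : normc (1 : R[i]) = 1 by exact: normc1.
have nN1 : normc (-1 : R[i]) = 1 by rewrite normcN normc1.
have hP m : (0 < m)%N -> normc (P m.+1 - P m) <= CC / (m%:R * m.+1%:R) * (normc (P m) + normc (Q m)).
  by move=> mp; rewrite stepP//; exact: rem_bound.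
have hQ m : (0 < m)%N -> normc (Q m.+1) <= damp m * normc (Q m) +
    CC / (m%:R * m.+1%:R) * (normc (P m) + normc (Q m)).
  move=> mp; rewrite stepQ//; apply: le_trans (le_normcD _ _) _; rewrite normcN; apply: lerD.
    by rewrite (normcM (_ / _)).
  exact: rem_bound.
pose dl := complex.Re x / (1 + normc x) ^+ 2.
have dl0 : 0 < dl by rewrite divr_gt0// exprn_gt0// ltr_wpDr ?normc_ge0.
have hd m : (0 < m)%N -> damp m <= 1 - dl / m.+1%:R by move=> _; exact: damp_bound.
have hd1 m : (0 < m)%N -> damp m <= 1.
  by move=> mp; apply: le_trans (hd _ mp) _; rewrite gerBl divr_ge0// ltW.
have cQ := perturbation_decay CC0 hd1 hP hQ dl0 hd.
have [l [cP hl]] := perturbation_cvg CC0 hd1 hP hQ m00 hm0.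
have i2x : 2 * x != 0 by rewrite mulf_neq0 ?x_neq0// pnatr_eq0.
exists (l / (2 * x)); split.
- have h : (P m + Q m) / (2 * x) @[m --> \oo] --> (l + 0) / (2 * x).
    exact: (cvgcM (cvgcD cP cQ) (cvg_cst _)).
  rewrite addr0 in h; apply: cvg_trans h; apply: near_eq_cvg; apply: nearW => m /=.
  by rewrite -cNE.
- have h : ((x - d) * P m - (x + d) * Q m) / (2 * x) @[m --> \oo] --> ((x - d) * l - (x + d) * 0) / (2 * x).
    exact: (cvgcM (cvgcB (cvgcM (cvg_cst _) cP) (cvgcM (cvg_cst _) cQ)) (cvg_cst _)).
  rewrite mulr0 subr0 -mulrA in h; apply: cvg_trans h; apply: near_eq_cvg; apply: nearW => m /=.
  by rewrite -eNE.
- move=> he0 hc0; rewrite mulf_neq0 ?invr_eq0//; apply/eqP => l0.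
  have Q0 : Q m0 = 0 by rewrite /Q he0 subrr mul0r.
  have P0 : P m0 != 0.
    rewrite /P he0 -mulrDl mulf_neq0 ?invr_eq0 ?growth_neq0// mulf_neq0//.
    by have -> : x - d + (x + d) = 2 * x by ring.
  move: hl; rewrite l0 Q0 normc0 sub0r normcN addr0 -normc_gt0 in P0 *; lra.
Qed.

End OneSolution.

(** One starting index m0 serves all solutions; with it a solution having a
    non-zero dominant coefficient can be prescribed at m0. *)
Lemma dominant_threshold : exists2 m0, (0 < m0)%N & forall c e, euler_system c e ->
  exists l : R[i], [/\ c m / growth m @[m --> \oo] --> l,
     e m / growth m @[m --> \oo] --> (x - d) * l &
     e m0 = (x - d) * c m0 -> c m0 != 0 -> l != 0].
Proof.
exists (Num.truncn (4 * CC)).+1 => // c e hce.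
by apply: dominant_limit => //; apply: ltW; exact: truncnS_gt.
Qed.

End Dominant.

(** * Contraction of the fractions and Worpitzky's bound *)

Section Contraction.
Context {R : realType}.
Variables alpha beta : R[i].
Local Notation kap := (kappa alpha beta).
Local Notation dp := (divergence_point alpha beta).
Local Notation p := (p_coef alpha beta).
Local Notation q := (q_coef alpha beta).
Local Notation ys := (kappa_sol alpha beta).

(** x^2 + q_m; the leading term of that fraction is half of x^2 + q_0. *)
Definition p_denom (x : R[i]) m : R[i] := x ^+ 2 + q m.
Definition p_denom0 (x : R[i]) : R[i] := (x ^+ 2 + q 0) / 2.

Lemma p_coefE j m : p m.+1 = - (kap j (2 * m).+1 * kap j (2 * m).+2).
Proof.
have h := odd_neq0 (R := R) m.
rewrite kappa_oddE kappa_evenE /p_coef; cbv zeta; rewrite -[m.+1%:R]natr1.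
have -> : 2 * (m%:R + 1) - 1 = 2 * m%:R + 1 :> R[i] by ring.
by case: j => [|[|[|j]]] /=; rewrite /kappa_odd_num /kappa_even_num; field; rewrite ?h.
Qed.

Lemma p_denomE j x m :
  p_denom x m.+1 = x ^+ 2 - dp j ^+ 2 + kap j (2 * m).+2 + kap j (2 * m.+1).+1.
Proof.
have h := odd_neq0 (R := R) m; have h' := odd_neq0 (R := R) m.+1.
rewrite kappa_oddE kappa_evenE /p_denom /q_coef; cbv zeta.
rewrite -[m.+1%:R]natr1 in h' *.
have -> : 2 * (m%:R + 1) - 1 = 2 * m%:R + 1 :> R[i] by ring.
have h2 : 2 * m%:R + 3 != 0 :> R[i].
  by have -> : 2 * m%:R + 3 = 2 * (m%:R + 1) + 1 :> R[i] by ring.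
by case: j => [|[|[|j]]] /=; rewrite /kappa_odd_num /kappa_even_num -?[m.+1%:R]natr1; field; rewrite ?h ?h' ?h2.
Qed.

Lemma p_denom0E j x : p_denom0 x = kappa_b0 alpha beta j x + kap j 1.
Proof.
have -> : 1%N = (2 * 0).+1 by [].
rewrite kappa_oddE /p_denom0 /kappa_b0 /q_coef /kappa_odd_num; cbv zeta.
by case: j => [|[|[|j]]] /=; field.
Qed.

(** Eliminating y_(2m) from the recurrence of the j-th fraction leaves a
    three-term recurrence for the y_(2m-1), with p_m = - kappa_(2m-1)
    kappa_(2m) and x^2 + q_m = lambda_(2m) + kappa_(2m) + kappa_(2m+1)
    for each j. *)
Lemma contraction j x u v u' v' m :
  u' = u -> v' = v + kap j 1 * u ->
  cf_sol p (p_denom x) u' v' m = ((ys j x u v m).1, (ys j x u v m.+1).1).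
Proof.
move=> -> ->; elim: m => [|m IH].
  by rewrite kappa_solS /kappa_step /kappa_sol muln0 /=.
rewrite cf_solS IH; cbn [fst snd]; rewrite !kappa_solS; case: (ys j x u v m) => a b.
rewrite /kappa_step /= (p_coefE j) (p_denomE j); congr (_, _); ring.
Qed.

Let a := 1 - alpha - beta.
Let S := normc a ^+ 2 + normc alpha ^+ 2 + normc beta ^+ 2.
Let G := normc (alpha - alpha ^+ 2 + beta - beta ^+ 2 - alpha * beta) / 2 +
   normc (alpha * beta * (- 1 + alpha + beta)) / 2.

Let S0 : 0 <= S. Proof.
have := sqr_ge0 (normc a); have := sqr_ge0 (normc alpha); have := sqr_ge0 (normc beta).
by rewrite /S; lra.
Qed.
Let G0 : 0 <= G. Proof. by rewrite /G addr_ge0// divr_ge0// normc_ge0. Qed.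

(** Chosen so that |p_m| <= |x^2 + q_m| |x^2 + q_(m-1)| / 4 for all m once
    Re (x^2) exceeds it. *)
Definition worpitzky_threshold : R := G + 1 + S + S ^+ 2.

Lemma worpitzky_threshold_ge0 : 0 <= worpitzky_threshold.
Proof. by have := sqr_ge0 S; have := S0; have := G0; rewrite /worpitzky_threshold; lra. Qed.

Lemma Re_le (z : R[i]) : complex.Re z <= normc z.
Proof. exact: le_trans (ler_norm _) (Re_le_normc _). Qed.

Lemma odd_norm_ge1 m : 1 <= normc (2 * m%:R - 1 : R[i]).
Proof.
case: m => [|m]; first by rewrite mulr0 sub0r normcN normc1.
have -> : 2 * m.+1%:R - 1 = (2 * m + 1)%:R :> R[i].
  by rewrite natrD natrM -[m.+1%:R]natr1; ring.
by rewrite normc_nat ler1n addn1.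
Qed.

Lemma q_coef_near m : normc (q m - 2 * m%:R ^+ 2) <= G.
Proof.
have h1 := odd_norm_ge1 m.
have h2 : 1 <= normc (2 * m%:R + 1 : R[i]).
  by rewrite -natrM natr1 normc_nat ler1n.
have h : 1 <= normc (2 * m%:R - 1 : R[i]) * normc (2 * m%:R + 1 : R[i]).
  by rewrite -[leLHS]mul1r ler_pM.
have n1 : 2 * m%:R - 1 != 0 :> R[i] by rewrite -normc_gt0 (lt_le_trans _ h1).
have n2 := odd_neq0 (R := R) m.
have -> : q m - 2 * m%:R ^+ 2 =
  (alpha - alpha ^+ 2 + beta - beta ^+ 2 - alpha * beta) / 2 +
  alpha * beta * (- 1 + alpha + beta) / (2 * ((2 * m%:R - 1) * (2 * m%:R + 1))).
  by rewrite /q_coef; cbv zeta; field; rewrite n1 n2.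
apply: le_trans (le_normcD _ _) _; rewrite /G; apply: lerD.
  by rewrite normcM normcV normc_nat.
rewrite normcM normcV ler_wpM2l ?normc_ge0// !normcM normc_nat lef_pV2 ?posrE//; last first.
  by rewrite mulr_gt0// (lt_le_trans _ h).
by rewrite ler_peMr.
Qed.

Section LargeX.
Variable x : R[i].
Hypothesis hx : worpitzky_threshold <= complex.Re (x ^+ 2).

Let Yr : R := complex.Re (x ^+ 2) - G.
Let lowb m : R := Yr + 2 * m%:R ^+ 2.

Let Yr_ge : 1 + S + S ^+ 2 <= Yr.
Proof. by move: hx; rewrite /worpitzky_threshold /Yr; lra. Qed.

Let lowb_gt1 m : 1 <= lowb m.
Proof.
have := Yr_ge; have := S0; have := sqr_ge0 S.
have : 0 <= 2 * m%:R ^+ 2 :> R by rewrite mulr_ge0// exprn_ge0.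
rewrite /lowb; lra.
Qed.

Lemma p_denom_low m : lowb m <= normc (p_denom x m).
Proof.
apply: le_trans (Re_le _).
have -> : p_denom x m = x ^+ 2 + (2 * m%:R ^+ 2 : R)%:C%C + (q m - 2 * m%:R ^+ 2).
  by rewrite /p_denom rmorphM rmorphXn !rmorph_nat; ring.
have := q_coef_near m; move: (q m - _) => z hz.
have := Re_le (- z); rewrite normcN !raddfD raddfN /= /lowb /Yr => h.
by move: hz h; move: G (normc z) (complex.Re z) => g nz rz; lra.
Qed.

(** With u = 2 m + 1 both sides start with u^4 / 16: the ratio
    p_m / ((x^2 + q_m) (x^2 + q_(m-1))) tends to -1/4, the critical value in
    Worpitzky's theorem, and it is the next term of the expansion that
    decides, in favour of large Re (x^2). *)
Lemma p_coef_bound m : normc (p m.+1) <= lowb m.+1 * lowb m / 4.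
Proof.
set u : R := 2 * m%:R + 1.
have mR : 0 <= m%:R :> R by [].
have u1 : 1 <= u by rewrite /u; lra.
have u0 : 0 < u by lra.
have uC : (2 * m%:R + 1 : R[i]) = u%:C%C by rewrite /u rmorphD rmorphM rmorph1 !rmorph_nat.
have un : u%:C%C != 0 :> R[i] by rewrite -uC odd_neq0.
have E : p m.+1 = - ((u%:C%C ^+ 2 - a ^+ 2) * (u%:C%C ^+ 2 - alpha ^+ 2) * (u%:C%C ^+ 2 - beta ^+ 2) / (16 * u%:C%C ^+ 2)).
  rewrite /p_coef; cbv zeta; rewrite -[m.+1%:R]natr1.
  have -> : 2 * (m%:R + 1) - 1 = u%:C%C :> R[i] by rewrite -uC; ring.
  have -> : 2 * (m%:R + 1) = u%:C%C + 1 :> R[i] by rewrite -uC; ring.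
  by rewrite /a; field.
have f (z : R[i]) : normc z ^+ 2 <= S -> normc (u%:C%C ^+ 2 - z ^+ 2) <= u ^+ 2 + S.
  move=> hz; apply: le_trans (le_normcD _ _) _; rewrite normcN !normcX normc_real real_normK ?num_real//.
  by rewrite lerD2l.
have fa := f a; have fb := f alpha; have fc := f beta.
have [n1 n2 n3] : [/\ normc a ^+ 2 <= S, normc alpha ^+ 2 <= S & normc beta ^+ 2 <= S].
  rewrite /S; move: (normc a ^+ 2) (normc alpha ^+ 2) (normc beta ^+ 2)
    (sqr_ge0 (normc a)) (sqr_ge0 (normc alpha)) (sqr_ge0 (normc beta)) => A B C hA hB hC.
  by split; lra.
have uS : 0 <= u ^+ 2 + S by rewrite addr_ge0// sqr_ge0.
have b1 : normc (p m.+1) <= (u ^+ 2 + S) ^+ 3 / (16 * u ^+ 2).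
  rewrite E normcN normcM normcV; have -> : normc (16 * u%:C%C ^+ 2) = 16 * u ^+ 2.
    by rewrite normcM normc_nat normcX normc_real real_normK ?num_real.
  have d0 : 0 <= (16 * u ^+ 2)^-1 by rewrite invr_ge0; have := sqr_ge0 u; lra.
  apply: (ler_wpM2r d0); rewrite !normcM.
  have -> : (u ^+ 2 + S) ^+ 3 = (u ^+ 2 + S) * (u ^+ 2 + S) * (u ^+ 2 + S) by ring.
  by rewrite !ler_pM ?mulr_ge0 ?normc_ge0// ?fa ?fb ?fc.
apply: le_trans b1 _; rewrite ler_pdivrMr ?mulr_gt0 ?exprn_gt0//.
have -> : lowb m.+1 * lowb m / 4 * (16 * u ^+ 2) = 4 * (lowb m.+1 * lowb m) * u ^+ 2 by field.
have -> : 4 * (lowb m.+1 * lowb m) = (2 * Yr + u ^+ 2 + 1) ^+ 2 - 4 * u ^+ 2.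
  by rewrite /lowb -natr1 /u; ring.
have := Yr_ge; have := S0; move: (Yr) (S) => Y0 s s0 hY.
have v1 : 1 <= u ^+ 2 by rewrite expr2; nra.
move: (u ^+ 2) v1 => v v1.
have h1 : 3 * s <= 4 * Y0 - 2 by have := sqr_ge0 s; lra.
have h2 : 3 * s ^+ 2 + s ^+ 3 <= (2 * Y0 + 1) ^+ 2.
  apply: le_trans (_ : (3 + 2 * s + 2 * s ^+ 2) ^+ 2 <= _); last first.
    have z0 : 0 <= s ^+ 2 by exact: sqr_ge0.
    by rewrite lerXn2r// ?nnegrE; lra.
  have z0 : 0 <= s ^+ 2 by exact: sqr_ge0.
  have z3 : 0 <= s ^+ 3 by exact: exprn_ge0.
  have z4 : 0 <= s ^+ 4 by exact: exprn_ge0.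
  have -> : (3 + 2 * s + 2 * s ^+ 2) ^+ 2 = 9 + 12 * s + 16 * s ^+ 2 + 8 * s ^+ 3 + 4 * s ^+ 4 by ring.
  lra.
have z3 : 0 <= s ^+ 3 by exact: exprn_ge0.
have e1 : 3 * s * v ^+ 2 <= (4 * Y0 - 2) * v ^+ 2 by rewrite ler_wpM2r ?sqr_ge0.
have e2 : (3 * s ^+ 2 + s ^+ 3) * v <= (2 * Y0 + 1) ^+ 2 * v by rewrite ler_wpM2r//; lra.
have e3 : s ^+ 3 <= s ^+ 3 * v by rewrite ler_peMr.
have -> : (v + s) ^+ 3 = v ^+ 3 + 3 * s * v ^+ 2 + 3 * s ^+ 2 * v + s ^+ 3 by ring.
have -> : ((2 * Y0 + v + 1) ^+ 2 - 4 * v) * v = v ^+ 3 + (4 * Y0 - 2) * v ^+ 2 + (2 * Y0 + 1) ^+ 2 * v by ring.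
lra.
Qed.

(** Worpitzky's induction: a tail of modulus at most |b| / 2 leaves a
    denominator of modulus at least |b| / 2. *)
Lemma segment_bound m n : exists z : R[i],
  [/\ cf_segment p (p_denom x) m.+1 n = fin_pt z, normc z <= lowb m / 2 &
      normc z <= 2 * normc (p m.+1) ].
Proof.
elim: n m => [|n IH] m.
  exists 0; split=> //; rewrite normc0; first by have := lowb_gt1 m; lra.
  by have := normc_ge0 (p m.+1); lra.
have [z [e h1 h2]] := IH m.+1; rewrite /= e /=.
have d1 : lowb m.+1 / 2 <= normc (p_denom x m.+1 + z).
  have := p_denom_low m.+1; have := le_normcB (p_denom x m.+1) (- z); rewrite opprK normcN; lra.
have l1 := lowb_gt1 m.+1.
have d0 : 0 < normc (p_denom x m.+1 + z) by apply: lt_le_trans d1; lra.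
exists (p m.+1 / (p_denom x m.+1 + z)); split.
- rewrite /sph_div /=; case: eqP => [->|_]; first by rewrite mul0r.
  by rewrite -normc_eq0 gt_eqF.
- rewrite normcM normcV ler_pdivrMr//; apply: le_trans (p_coef_bound m) _.
  have l0 := lowb_gt1 m.
  apply: le_trans (_ : lowb m / 2 * (lowb m.+1 / 2) <= _); first lra.
  by rewrite ler_wpM2l//; lra.
- rewrite normcM normcV ler_pdivrMr//; have := normc_ge0 (p m.+1); nra.
Qed.

(** The linear form of the bound keeps its meaning when both sides are divided
    by a growth factor, so it survives the limit in n. *)
Lemma worpitzky n : (forall k, (0 < k <= n)%N -> p k != 0) ->
  normc ((cf_sol p (p_denom x) 1 (p_denom0 x) n).2 - p_denom0 x * (cf_sol p (p_denom x) 0 1 n).2) <=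
  2 * normc (p 1) * normc (cf_sol p (p_denom x) 0 1 n).2.
Proof.
move=> hp; have [+ _] := cf_approximant_sol (p_denom x) (p_denom0 x) hp.
rewrite /cf_approximant; have [z [-> _ hz]] := segment_bound 0 n.
rewrite /= /ratio_pt; case: eqP => // /eqP B0 [] E.
have -> : (cf_sol p (p_denom x) 1 (p_denom0 x) n).2 = (p_denom0 x + z) * (cf_sol p (p_denom x) 0 1 n).2.
  by rewrite E divfK.
by rewrite -mulrBl [p_denom0 x + z]addrC addrK normcM ler_wpM2r ?normc_ge0.
Qed.

End LargeX.
End Contraction.

(** * Identifying a value by its functional equation *)

Section Assembly.
Context {R : realType}.
Variables alpha beta : R[i].
Local Notation num := (quotient_num alpha beta).
Local Notation den := (quotient_den alpha beta).

Lemma near_dist (x : R[i]) (e : R) : 0 < e -> \forall z \near x, normc (z - x) < e.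
Proof.
move=> e0; have : z @[z --> x] --> x by [].
by move=> /cvgcP/(_ _ e0).
Qed.

Lemma cvgc_dnbhs (f : R[i] -> R[i]) (x l : R[i]) :
  f z @[z --> x] --> l -> f z @[z --> x^'] --> l.
Proof.
move=> /cvgcP h; apply/cvgcP => e e0; rewrite near_withinE.
by apply: filterS (h _ e0) => z hz _.
Qed.

Lemma near_neq (x c : R[i]) : \forall z \near x^', z != c.
Proof.
have [->|xc] := eqVneq x c; first by rewrite near_withinE; apply: nearW.
rewrite near_withinE; have h : 0 < normc (c - x) by rewrite normc_gt0 subr_eq0 eq_sym.
apply: filterS (near_dist x h) => z hz _.
by apply: contraTneq hz => ->; rewrite ltxx.
Qed.

(** The zeros of z |-> z + g + 2 k, k natural, are isolated. *)
Lemma near_no_zero (x g : R[i]) : \forall z \near x^', forall k : nat, z + g + 2 * k%:R != 0.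
Proof.
pose N := (Num.truncn (normc x + 1 + normc g)).+1.
have hN : normc x + 1 + normc g < N%:R by exact: truncnS_gt.
have h1 n : \forall z \near x^', forall k : nat, (k < n)%N -> z + g + 2 * k%:R != 0.
  elim: n => [|n IH]; first by apply: nearW.
  apply: filterS2 (near_neq x (- (g + 2 * n%:R))) IH => z hz IH k.
  rewrite ltnS leq_eqVlt => /predU1P[->|]; last exact: IH.
  by rewrite -addrA addr_eq0.
have h2 : \forall z \near x^', normc (z - x) < 1.
  by rewrite near_withinE; apply: filterS (near_dist x ltr01) => z hz _.
apply: filterS2 (h1 N) h2 => z hz zx k; have [kN|Nk] := ltnP k N; first exact: hz.
rewrite -normc_gt0.
have k1 : N%:R <= k%:R :> R by rewrite ler_nat.
have -> : z + g + 2 * k%:R = 2 * k%:R - (- ((z - x) + x + g)) by ring.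
apply: lt_le_trans (le_normcB _ _); rewrite normcN normcM !normc_nat subr_gt0.
have := le_normcD (z - x + x) g; have := le_normcD (z - x) x.
have : 0 <= k%:R :> R by []. lra.
Qed.

Lemma regular_near (x : R[i]) : \forall z \near x^', regular alpha beta z.
Proof.
have := near_no_zero x alpha; have := near_no_zero x (- alpha - beta + 1).
have := near_no_zero x beta; have := near_no_zero x (- alpha + 2).
have := near_no_zero x (alpha + beta + 1); have := near_no_zero x (- beta + 2).
move=> h6 h5 h4 h3 h2 h1.
near=> z => k.
have e1 : forall i : nat, z + alpha + 2 * i%:R != 0 by near: z; exact: h1.
have e2 : forall i : nat, z + (- alpha - beta + 1) + 2 * i%:R != 0 by near: z; exact: h2.
have e3 : forall i : nat, z + beta + 2 * i%:R != 0 by near: z; exact: h3.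
have e4 : forall i : nat, z + (- alpha + 2) + 2 * i%:R != 0 by near: z; exact: h4.
have e5 : forall i : nat, z + (alpha + beta + 1) + 2 * i%:R != 0 by near: z; exact: h5.
have e6 : forall i : nat, z + (- beta + 2) + 2 * i%:R != 0 by near: z; exact: h6.
move: (e1 k) (e2 k) (e3 k) (e4 k) (e5 k) (e6 k) => {}e1 {}e2 {}e3 {}e4 {}e5 {}e6.
rewrite /quotient_num /quotient_den; split; apply: mulf_neq0; try apply: mulf_neq0.
- by apply: contra_neq e1 => <-; ring.
- by apply: contra_neq e2 => <-; ring.
- by apply: contra_neq e3 => <-; ring.
- by apply: contra_neq e4 => <-; ring.
- by apply: contra_neq e5 => <-; ring.
- by apply: contra_neq e6 => <-; ring.
Unshelve. all: by end_near. Qed.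

Definition prod_num (x : R[i]) n : R[i] := \prod_(0 <= k < n) num (x + 2 * k%:R).
Definition prod_den (x : R[i]) n : R[i] := \prod_(0 <= k < n) den (x + 2 * k%:R).

Variables (D : R[i] -> Prop) (A B t : R[i] -> R[i]) (C0 C1 : R).
Hypothesis D_shift : forall x, D x -> D (x + 2).
Hypothesis AB_neq0 : forall x, D x -> (A x != 0) || (B x != 0).
Hypothesis A_shift : forall x, D x -> t x * A x = num x * A (x + 2).
Hypothesis B_shift : forall x, D x -> t x * B x = den x * B (x + 2).
Hypothesis C0_ge0 : 0 <= C0.
Hypothesis AB_large : forall x, D x -> C0 <= complex.Re (x ^+ 2) ->
  normc (A x - p_denom0 alpha beta x * B x) <= C1 * normc (B x).

Lemma D_shiftn (x : R[i]) n : D x -> D (x + 2 * n%:R).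
Proof.
move=> Dx; elim: n => [|n IH]; first by rewrite mulr0 addr0.
by have := D_shift IH; congr D; rewrite -[n.+1%:R]natr1; ring.
Qed.

Definition prod_t (x : R[i]) n : R[i] := \prod_(0 <= k < n) t (x + 2 * k%:R).

Lemma shift_step (x : R[i]) n : x + 2 * n%:R + 2 = x + 2 * n.+1%:R.
Proof. by rewrite -[n.+1%:R]natr1; ring. Qed.

Lemma A_iter x n : D x -> prod_t x n * A x = prod_num x n * A (x + 2 * n%:R).
Proof.
move=> Dx; elim: n => [|n IH].
  by rewrite /prod_t /prod_num !big_geq// mulr0 addr0.
rewrite /prod_t /prod_num !big_nat_recr//= -/(prod_t x n) -/(prod_num x n).
rewrite -shift_step mulrAC IH mulrAC -[in RHS]mulrA -A_shift; last exact: D_shiftn.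
by ring.
Qed.

Lemma B_iter x n : D x -> prod_t x n * B x = prod_den x n * B (x + 2 * n%:R).
Proof.
move=> Dx; elim: n => [|n IH].
  by rewrite /prod_t /prod_den !big_geq// mulr0 addr0.
rewrite /prod_t /prod_den !big_nat_recr//= -/(prod_t x n) -/(prod_den x n).
rewrite -shift_step mulrAC IH mulrAC -[in RHS]mulrA -B_shift; last exact: D_shiftn.
by ring.
Qed.

(** If t vanished, then so would both coordinates at the next shift. *)
Lemma t_regular x n : D x -> regular alpha beta x -> prod_t x n != 0.
Proof.
move=> Dx hr; rewrite prodf_seq_neq0; apply/allP => k _ /=.
have Dk := D_shiftn k Dx; apply/eqP => t0.
have [h1 h2] := hr k; have := A_shift Dk; have := B_shift Dk.
rewrite t0 !mul0r => /esym/eqP; rewrite mulf_eq0 (negPf h2)/= => /eqP hB.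
move=> /esym/eqP; rewrite mulf_eq0 (negPf h1)/= => /eqP hA.
by have := AB_neq0 (D_shift Dk); rewrite hA hB eqxx.
Qed.

Lemma Re_sqr (x : R[i]) : complex.Re (x ^+ 2) = complex.Re x ^+ 2 - complex.Im x ^+ 2.
Proof. by case: x => a b; rewrite expr2 /= !expr2. Qed.

(** Moving to the right by 2 n makes Re (x^2) large, uniformly on bounded
    sets. *)
Lemma large_shift (M L : R) : 0 <= M -> exists N, forall n z, (N <= n)%N -> normc z <= M ->
  L <= complex.Re ((z + 2 * n%:R) ^+ 2).
Proof.
move=> M0; exists (Num.truncn (M + `|L| + 1)).+1 => n z Nn zM.
have hn : M + `|L| + 1 < n%:R.
  by apply: lt_le_trans (truncnS_gt _) _; rewrite ler_nat.
rewrite Re_sqr.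
have -> : z + 2 * n%:R = z + (2 * n%:R : R)%:C%C by rewrite rmorphM !rmorph_nat.
rewrite !raddfD /= addr0.
have := le_trans (Re_le_normc z) zM; have := le_trans (Im_le_normc z) zM.
rewrite !ler_norml => /andP[i1 i2] /andP[q1 q2]; have := ler_norm L.
move: (complex.Re z) (complex.Im z) (n%:R : R) hn i1 i2 q1 q2 => a b m hn i1 i2 q1 q2 hL.
have L0 : 0 <= `|L| by [].
have h1 : (M + (2 * `|L| + 2)) ^+ 2 <= (a + 2 * m) ^+ 2.
  by rewrite lerXn2r// ?nnegrE; lra.
have h2 : b ^+ 2 <= M ^+ 2 by nra.
have : 0 <= M * (2 * `|L| + 2) by rewrite mulr_ge0//; lra.
have : 0 <= (2 * `|L| + 1) ^+ 2 by exact: sqr_ge0.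
have : (M + (2 * `|L| + 2)) ^+ 2 = M ^+ 2 + 2 * (M * (2 * `|L| + 2)) + ((2 * `|L| + 1) ^+ 2 + 4 * `|L| + 3) by ring.
lra.
Qed.

Lemma B_large x : D x -> C0 <= complex.Re (x ^+ 2) -> B x != 0.
Proof.
move=> Dx hx; apply/eqP => B0; have := AB_large Dx hx; have := AB_neq0 Dx.
rewrite B0 eqxx orbF mulr0 subr0 normc0 mulr0 => A0.
by rewrite leNgt normc_gt0 A0.
Qed.

Lemma ratio_large x : D x -> C0 <= complex.Re (x ^+ 2) ->
  normc (A x / B x - p_denom0 alpha beta x) <= C1.
Proof.
move=> Dx hx; have B0 := B_large Dx hx.
have -> : A x / B x - p_denom0 alpha beta x = (A x - p_denom0 alpha beta x * B x) / B x by field.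
by rewrite normcM normcV ler_pdivrMr ?normc_gt0// AB_large.
Qed.

Lemma quotient_prodE x n : quotient_prod alpha beta x n = prod_den x n / prod_num x n.
Proof. by rewrite /quotient_prod /prod_den /prod_num -prodf_div. Qed.

Lemma prod_num_neq0 x n : regular alpha beta x -> prod_num x n != 0.
Proof. by move=> hr; rewrite prodf_seq_neq0; apply/allP => k _; have [] := hr k. Qed.

Lemma prod_den_neq0 x n : regular alpha beta x -> prod_den x n != 0.
Proof. by move=> hr; rewrite prodf_seq_neq0; apply/allP => k _; have [] := hr k. Qed.

Lemma cvgc_inv_nat : (n.+1%:R : R[i])^-1 @[n --> \oo] --> (0 : R[i]).
Proof.
apply/cvgcP => e e0; have := @cvg_harmonic R; move/cvgrPdist_lt => /(_ _ e0).
apply: filterS => n; rewrite sub0r normrN subr0 normcV normc_nat.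
by rewrite /harmonic /= ger0_norm.
Qed.

(** Iterate the functional equation up to x + 2 n, where A / B is
    (x + 2 n)^2 / 2 + O(1), and compare with the product for the Gamma
    quotient: this gives A(x) / B(x) times the Gamma quotient = 2. *)
Lemma regular_value x : D x -> regular alpha beta x ->
  A x != 0 /\ Gamma_quotient_fin alpha beta x = 2 * B x / A x.
Proof.
move=> Dx hr.
have [N hN] := @large_shift (normc x) C0 (normc_ge0 x).
have large n : (N <= n)%N -> C0 <= complex.Re ((x + 2 * n%:R) ^+ 2) by move=> /hN; exact.
have Bx : B x != 0.
  have h := B_iter N Dx; apply/eqP => B0; move: h; rewrite B0 mulr0 => /esym/eqP.
  rewrite mulf_eq0 (negPf (prod_den_neq0 N hr))/=; apply/negP.
  exact: B_large (D_shiftn N Dx) (large _ (leqnn N)).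
(* A / B times the partial product is A / B at x + 2 n. *)
have key n : (N <= n)%N ->
    normc (A x / B x * quotient_prod alpha beta x n - p_denom0 alpha beta (x + 2 * n%:R)) <= C1.
  move=> Nn; have Dn := D_shiftn n Dx; have := ratio_large Dn (large _ Nn).
  have Bn := B_large Dn (large _ Nn).
  have -> : A (x + 2 * n%:R) / B (x + 2 * n%:R) = A x / B x * quotient_prod alpha beta x n => //.
  have tn := t_regular n Dx hr; have nn := prod_num_neq0 n hr; have dn := prod_den_neq0 n hr.
  rewrite quotient_prodE.
  have eA : A (x + 2 * n%:R) = prod_t x n * A x / prod_num x n.
    by rewrite A_iter// mulrAC divff// mul1r.
  have eB : B (x + 2 * n%:R) = prod_t x n * B x / prod_den x n.
    by rewrite B_iter// mulrAC divff// mul1r.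
  by rewrite eA eB; field; rewrite tn nn dn Bx.
have inv0 := cvgc_inv_nat.
have lim2 : A x / B x * quotient_prod alpha beta x n.+2 / n.+1%:R ^+ 2 @[n --> \oo] --> (2 : R[i]).
  pose eps n := A x / B x * quotient_prod alpha beta x n.+2 - p_denom0 alpha beta (x + 2 * n.+2%:R).
  have e0 : eps n / n.+1%:R ^+ 2 @[n --> \oo] --> (0 : R[i]).
    apply/cvgcP => e e0; have C1p : 0 < `|C1| + 1 by rewrite ltr_wpDl.
    move/cvgcP : inv0 => /(_ _ (divr_gt0 e0 C1p)) [M _ hM].
    exists (maxn M N) => // n /=; rewrite geq_max => /andP[Mn Nn].
    have := hM _ Mn; rewrite !subr0 normcV normc_nat ltr_pdivlMr// => h.
    rewrite normcM normcV normcX normc_nat.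
    have hk : normc (eps n) <= C1 by apply: key; rewrite (leq_trans Nn)// ltnW.
    apply: le_lt_trans h; rewrite mulrC.
    have i1 : (n.+1%:R ^+ 2)^-1 <= n.+1%:R^-1 :> R.
      by rewrite lef_pV2 ?posrE ?exprn_gt0// expr2 ler_peMr// ler1n.
    apply: ler_pM => //; first exact: normc_ge0.
    by apply: (le_trans hk); apply: (le_trans (ler_norm _)); rewrite lerDl.
  have b0 : p_denom0 alpha beta (x + 2 * n.+2%:R) / n.+1%:R ^+ 2 @[n --> \oo] --> (2 : R[i]).
    pose w n : R[i] := (x + 2) * n.+1%:R^-1 + 2.
    have cw : w n @[n --> \oo] --> ((x + 2) * 0 + 2 : R[i]).
      exact: (cvgcD (cvgcM (cvg_cst _) inv0) (cvg_cst _)).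
    have h : (w n * w n + q_coef alpha beta 0 * (n.+1%:R^-1 * n.+1%:R^-1)) / 2 @[n --> \oo] -->
       ((((x + 2) * 0 + 2) * ((x + 2) * 0 + 2) + q_coef alpha beta 0 * (0 * 0)) / 2 : R[i]).
      exact: (cvgcM (cvgcD (cvgcM cw cw) (cvgcM (cvg_cst _) (cvgcM inv0 inv0))) (cvg_cst _)).
    have E : (((x + 2) * 0 + 2) * ((x + 2) * 0 + 2) + q_coef alpha beta 0 * (0 * 0)) / 2 = 2 :> R[i].
      by field.
    rewrite E in h; apply: cvg_trans h; apply: near_eq_cvg; apply: nearW => n /=.
    rewrite /p_denom0 /w; have n0 : (n.+1%:R : R[i]) != 0 by rewrite pnatr_eq0.
    have -> : (n.+2%:R : R[i]) = n.+1%:R + 1 by rewrite natr1.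
    by move: (n.+1%:R : R[i]) n0 => y yn; field.
  have h : eps n / n.+1%:R ^+ 2 + p_denom0 alpha beta (x + 2 * n.+2%:R) / n.+1%:R ^+ 2 @[n --> \oo] --> (0 + 2 : R[i]).
    exact: (cvgcD e0 b0).
  rewrite add0r in h; apply: cvg_trans h; apply: near_eq_cvg; apply: nearW => n /=.
  by rewrite -mulrDl /eps subrK.
have lim1 : A x / B x * quotient_prod alpha beta x n.+2 / n.+1%:R ^+ 2 @[n --> \oo] -->
    A x / B x * Gamma_quotient_fin alpha beta x.
  have h0 := quotient_prod_cvg hr; rewrite -cvg_shiftS in h0.
  have h : A x / B x * (quotient_prod alpha beta x n.+2 / n.+1%:R ^+ 2) @[n --> \oo] -->
     A x / B x * Gamma_quotient_fin alpha beta x.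
    exact: (cvgcM (cvg_cst _) h0).
  apply: cvg_trans h; apply: near_eq_cvg; apply: nearW => n /=.
  by rewrite mulrA.
have E := cvgc_unique lim1 lim2.
have Ax : A x != 0.
  have two0 : (2 : R[i]) != 0 by rewrite pnatr_eq0.
  by apply: contra_neq two0 => A0; rewrite -E A0 !mul0r.
split=> //; have -> : Gamma_quotient_fin alpha beta x = A x / B x * Gamma_quotient_fin alpha beta x * B x / A x.
  by field; rewrite Ax Bx.
by rewrite E.
Qed.

Lemma ratio_pt_regular x : D x -> regular alpha beta x ->
  fin_pt (Gamma_quotient_fin alpha beta x) = ratio_pt (2 * B x) (A x).
Proof.
by move=> Dx hr; have [Ax ->] := regular_value Dx hr; rewrite /ratio_pt (negPf Ax).
Qed.

Lemma ratio_pt_args_neq0 x : D x -> (2 * B x != 0) || (A x != 0).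
Proof.
by move=> Dx; rewrite mulf_eq0 pnatr_eq0/= orbC AB_neq0.
Qed.

Lemma Gamma_quotient_continuous (x : R[i]) : (forall z, D z) ->
  A z @[z --> x] --> A x -> B z @[z --> x] --> B x ->
  Gamma_quotient alpha beta x = ratio_pt (2 * B x) (A x).
Proof.
move=> DT cA cB; have [hr|hr] := pselect (regular alpha beta x).
  by rewrite Gamma_quotient_regular// ratio_pt_regular.
rewrite Gamma_quotient_pole//; apply: sphere_lim.
have cA' : A z @[z --> x^'] --> A x by exact: cvgc_dnbhs.
have cB' : B z @[z --> x^'] --> B x by exact: cvgc_dnbhs.
have c2B : 2 * B z @[z --> x^'] --> 2 * B x by exact: (cvgcM (cvg_cst _) cB').
have h : ratio_pt (2 * B z) (A z) @[z --> x^'] --> ratio_pt (2 * B x) (A x).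
  exact: (ratio_pt_cvg (ratio_pt_args_neq0 (DT x)) c2B cA').
apply: cvg_trans h; apply: near_eq_cvg.
by apply: filterS (regular_near x) => z hz; rewrite ratio_pt_regular.
Qed.

Lemma cvgc0_bounded {F : set_system R[i]} {FF : Filter F} (f g : R[i] -> R[i]) (C : R) :
  f z @[z --> F] --> (0 : R[i]) -> (\forall z \near F, normc (g z) <= C) ->
  f z * g z @[z --> F] --> (0 : R[i]).
Proof.
move=> /cvgcP hf hg; apply/cvgcP => e e0; have C1p : 0 < `|C| + 1 by rewrite ltr_wpDl.
apply: filterS2 (hf _ (divr_gt0 e0 C1p)) hg => z; rewrite !subr0 ltr_pdivlMr// => h1 h2.
rewrite normcM; apply: le_lt_trans h1; rewrite ler_wpM2l ?normc_ge0//.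
by apply: (le_trans h2); apply: (le_trans (ler_norm _)); rewrite lerDl.
Qed.

Lemma cvgc_ext (f g : R[i] -> R[i]) (x l : R[i]) :
  (forall z, f z = g z) -> g z @[z --> x] --> l -> f z @[z --> x] --> l.
Proof. by move=> /funext ->. Qed.

Lemma cvgc_shift (x c : R[i]) : z + c @[z --> x] --> x + c.
Proof.
have h : z @[z --> x] --> x by [].
exact: (cvgcD h (cvg_cst c)).
Qed.

Lemma prod_num_cvg (x : R[i]) n : prod_num z n @[z --> x] --> prod_num x n.
Proof.
elim: n => [|n IH].
  have E z : prod_num z 0 = 1 by rewrite /prod_num big_geq.
  rewrite E; apply: (@cvgc_ext (fun z => prod_num z 0) (fun=> 1) x 1 E); exact: (@cvg_cst R[i] 1 R[i] (nbhs x)).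
have E z : prod_num z n.+1 = prod_num z n * num (z + 2 * n%:R) by rewrite /prod_num big_nat_recr.
rewrite E; have h : prod_num z n * num (z + 2 * n%:R) @[z --> x] --> prod_num x n * num (x + 2 * n%:R).
  apply: (cvgcM IH); rewrite /quotient_num; have c0 := @cvgc_shift x (2 * n%:R).
  exact: (cvgcM (cvgcM (cvgcD c0 (cvg_cst _))
    (cvgcD (cvgcB (cvgcB c0 (cvg_cst _)) (cvg_cst _)) (cvg_cst _)))
    (cvgcD c0 (cvg_cst _))).
exact: (cvgc_ext E).
Qed.

Lemma prod_den_cvg (x : R[i]) n : prod_den z n @[z --> x] --> prod_den x n.
Proof.
elim: n => [|n IH].
  have E z : prod_den z 0 = 1 by rewrite /prod_den big_geq.
  rewrite E; apply: (@cvgc_ext (fun z => prod_den z 0) (fun=> 1) x 1 E); exact: (@cvg_cst R[i] 1 R[i] (nbhs x)).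
have E z : prod_den z n.+1 = prod_den z n * den (z + 2 * n%:R) by rewrite /prod_den big_nat_recr.
rewrite E; have h : prod_den z n * den (z + 2 * n%:R) @[z --> x] --> prod_den x n * den (x + 2 * n%:R).
  apply: (cvgcM IH); rewrite /quotient_den; have c0 := @cvgc_shift x (2 * n%:R).
  exact: (cvgcM (cvgcM (cvgcD (cvgcB c0 (cvg_cst _)) (cvg_cst _))
    (cvgcD (cvgcD (cvgcD c0 (cvg_cst _)) (cvg_cst _)) (cvg_cst _)))
    (cvgcD (cvgcB c0 (cvg_cst _)) (cvg_cst _))).
exact: (cvgc_ext E).
Qed.

(** N shifts bring x to a place w where rho = A(w) / B(w) is bounded and bounded
    away from 0.  Near x the quotient is 2 prod_den / (prod_num rho), where
    the products have N linear factors.  At a pole one of them vanishes at x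
    and, as the multiplier t is not 0, not both; so the limit is 0 or infinity
    and no knowledge of rho beyond its bounds enters. *)
Lemma Gamma_quotient_separated (x : R[i]) : D x -> (\forall z \near x, D z) ->
  (forall z, D z -> t z != 0) -> Gamma_quotient alpha beta x = ratio_pt (2 * B x) (A x).
Proof.
move=> Dx nD t0; have [hr|hr] := pselect (regular alpha beta x).
  by rewrite Gamma_quotient_regular// ratio_pt_regular.
rewrite Gamma_quotient_pole//; apply: sphere_lim.
have tn z n : D z -> prod_t z n != 0.
  by move=> Dz; rewrite prodf_seq_neq0; apply/allP => k _ /=; apply: t0; exact: D_shiftn.
move/existsNP : hr => [k hk].
pose q0 := normc (q_coef alpha beta 0).
pose L := C0 + (2 * (`|C1| + 1) + q0).
pose M := normc x + 1.
have M0 : 0 <= M by rewrite /M addr_ge0// normc_ge0.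
have q00 : 0 <= q0 by exact: normc_ge0.
have [N0 hN0] := large_shift L M0.
pose N := maxn N0 k.+1.
have zero : prod_num x N = 0 \/ prod_den x N = 0.
  have kN : (k < N)%N by rewrite leq_max leqnn orbT.
  have kin : k \in index_iota 0 N by rewrite mem_index_iota.
  move: hk; rewrite not_andE => -[] /negP; rewrite negbK => h; [left|right]; apply/eqP;
    by rewrite prodf_seq_eq0; apply/hasP; exists k.
have large z : normc z <= M -> L <= complex.Re ((z + 2 * N%:R) ^+ 2).
  by apply: hN0; rewrite leq_maxl.
have largeC z : normc z <= M -> C0 <= complex.Re ((z + 2 * N%:R) ^+ 2).
  by move=> /large; rewrite /L; have := normr_ge0 C1; lra.
pose rho (z : R[i]) : R[i] := A (z + 2 * N%:R) / B (z + 2 * N%:R).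
pose C2 := ((M + 2 * N%:R) ^+ 2 + q0) / 2 + C1.
have rho_bounds z : D z -> normc z <= M -> 1 <= normc (rho z) /\ normc (rho z) <= C2.
  move=> Dz zM; have Dw := D_shiftn N Dz.
  have hr0 := ratio_large Dw (largeC _ zM).
  set w := z + _ in hr0 *; have hw : normc w <= M + 2 * N%:R.
    by apply: le_trans (le_normcD _ _) _; rewrite normcM !normc_nat lerD2r.
  have Lw : L <= complex.Re (w ^+ 2) by exact: large.
  have b1 : (complex.Re (w ^+ 2) - q0) / 2 <= normc (p_denom0 alpha beta w).
    rewrite /p_denom0 normcM normcV normc_nat ler_wpM2r ?invr_ge0//.
    have := le_normcB (w ^+ 2) (- q_coef alpha beta 0); rewrite opprK normcN.
    by apply: le_trans; rewrite lerD2r Re_le.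
  have b2 : normc (p_denom0 alpha beta w) <= ((M + 2 * N%:R) ^+ 2 + q0) / 2.
    rewrite /p_denom0 normcM normcV normc_nat ler_wpM2r ?invr_ge0//.
    apply: le_trans (le_normcD _ _) _; rewrite lerD2r normcX.
    by rewrite lerXn2r// ?nnegrE ?normc_ge0// addr_ge0// mulr_ge0.
  rewrite -/(rho z) in hr0.
  have h1 : normc (p_denom0 alpha beta w) - normc (rho z - p_denom0 alpha beta w) <= normc (rho z).
    rewrite normc_distC; have := le_normcB (p_denom0 alpha beta w) (p_denom0 alpha beta w - rho z).
    by have -> : p_denom0 alpha beta w - (p_denom0 alpha beta w - rho z) = rho z by ring.
  have h2 := le_normcD (rho z - p_denom0 alpha beta w) (p_denom0 alpha beta w); rewrite subrK in h2.
  have hC1 := ler_norm C1; have hC0 := C0_ge0; rewrite /C2; rewrite /L in Lw.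
  by split; lra.
have near1 : \forall z \near x^', D z /\ normc z <= M.
  rewrite near_withinE; apply: filterS2 nD (near_dist x ltr01) => z Dz zx _; split=> //.
  have := le_normcD (z - x) x; rewrite subrK /M; lra.
have E z : D z -> normc z <= M -> ratio_pt (2 * B z) (A z) = ratio_pt (2 * prod_den z N) (prod_num z N * rho z).
  move=> Dz zM; have Bw := B_large (D_shiftn N Dz) (largeC _ zM).
  rewrite -(ratio_ptZ _ _ (tn z N Dz)) A_iter// mulrCA B_iter//.
  by rewrite -[RHS](ratio_ptZ _ _ Bw) /rho; congr ratio_pt; [ring | field].
have xM : normc x <= M by rewrite /M lerDl.
rewrite (E x)//.
suff h : ratio_pt (2 * prod_den z N) (prod_num z N * rho z) @[z --> x^'] -->
    ratio_pt (2 * prod_den x N) (prod_num x N * rho x).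
  apply: cvg_trans h; apply: near_eq_cvg.
  apply: filterS2 near1 (regular_near x) => z [Dz zM] hz.
  by rewrite ratio_pt_regular// E.
have cn : prod_num z N @[z --> x^'] --> prod_num x N by apply: cvgc_dnbhs; exact: prod_num_cvg.
have cd : prod_den z N @[z --> x^'] --> prod_den x N by apply: cvgc_dnbhs; exact: prod_den_cvg.
have nz : (2 * prod_den x N != 0) || (prod_num x N * rho x != 0).
  have := ratio_pt_args_neq0 Dx; have tx := tn x N Dx; have Bw := B_large (D_shiftn N Dx) (largeC _ xM).
  move=> /orP[h|h]; apply/orP; [left|right].
    have : prod_t x N * (2 * B x) != 0 by rewrite mulf_neq0.
    rewrite mulrCA B_iter// mulrA; apply: contra_neq => ->; by rewrite mul0r.
  have : prod_t x N * A x != 0 by rewrite mulf_neq0.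
  rewrite A_iter//; apply: contra_neq => h0.
  have -> : A (x + 2 * N%:R) = rho x * B (x + 2 * N%:R) by rewrite /rho divfK.
  by rewrite mulrA h0 mul0r.
have c2 : 2 * prod_den z N @[z --> x^'] --> 2 * prod_den x N by exact: (cvgcM (cvg_cst _) cd).
have [n0|d0] := zero.
  rewrite n0 in cn.
  have hb : \forall z \near x^', normc (rho z) <= C2.
    by apply: filterS near1 => z [Dz zM]; have [] := rho_bounds z Dz zM.
  have cnr : prod_num z N * rho z @[z --> x^'] --> (0 : R[i]) by exact: (cvgc0_bounded cn hb).
  by rewrite n0 mul0r in nz *; exact: (ratio_pt_cvg nz c2 cnr).
have rx : rho x != 0.
  by have [h _] := rho_bounds x Dx xM; rewrite -normc_gt0 (lt_le_trans _ h).
have rhoE z : rho z != 0 -> ratio_pt (2 * prod_den z N) (prod_num z N * rho z) =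
    ratio_pt (2 * prod_den z N * (rho z)^-1) (prod_num z N).
  move=> rz; rewrite -[RHS](ratio_ptZ _ _ rz); congr ratio_pt; last ring.
  by field.
rewrite rhoE//.
suff h : ratio_pt (2 * prod_den z N * (rho z)^-1) (prod_num z N) @[z --> x^'] -->
    ratio_pt (2 * prod_den x N * (rho x)^-1) (prod_num x N).
  apply: cvg_trans h; apply: near_eq_cvg; apply: filterS near1 => z [Dz zM].
  rewrite rhoE//; have [h _] := rho_bounds z Dz zM.
  by rewrite -normc_gt0 (lt_le_trans _ h).
rewrite d0 mulr0 in c2.
have hb : \forall z \near x^', normc (rho z)^-1 <= 1.
  apply: filterS near1 => z [Dz zM]; have [h _] := rho_bounds z Dz zM.
  by rewrite normcV invf_le1// (lt_le_trans _ h).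
have cdr : 2 * prod_den z N * (rho z)^-1 @[z --> x^'] --> (0 : R[i]) by exact: (cvgc0_bounded c2 hb).
have nz' : ((0 : R[i]) != 0) || (prod_num x N != 0).
  by move: nz; rewrite d0 mulr0 eqxx mulf_eq0 negb_or/= => /andP[].
by rewrite d0 mulr0 mul0r; exact: (ratio_pt_cvg nz' cdr cn).
Qed.

End Assembly.

(** * Vanishing partial numerators *)

Section Parity.
Context {R : realType}.
Variables alpha beta : R[i].
Local Notation kap := (kappa alpha beta).

Lemma kappa_num_prod j m : let u : R[i] := 2 * m%:R + 1 in
  kappa_odd_num alpha beta j m * kappa_even_num alpha beta j m =
  (u ^+ 2 - (1 - alpha - beta) ^+ 2) * (u ^+ 2 - alpha ^+ 2) * (u ^+ 2 - beta ^+ 2).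
Proof. by case: j => [|[|[|j]]] /=; rewrite /kappa_odd_num /kappa_even_num; ring. Qed.

Lemma four_odd_neq0 m : 4 * (2 * m%:R + 1) != 0 :> R[i].
Proof. by rewrite mulf_neq0 ?odd_neq0// pnatr_eq0. Qed.

Lemma kappa_odd_eq0 j m : (kap j (2 * m).+1 == 0) = (kappa_odd_num alpha beta j m == 0).
Proof. by rewrite kappa_oddE mulf_eq0 invr_eq0 (negPf (four_odd_neq0 m)) orbF. Qed.

Lemma kappa_even_eq0 j m : (kap j (2 * m).+2 == 0) = (kappa_even_num alpha beta j m == 0).
Proof. by rewrite kappa_evenE mulf_eq0 invr_eq0 (negPf (four_odd_neq0 m)) orbF. Qed.

Lemma odd_integerP (z : R[i]) :
  odd_integer z <-> exists m : nat, (2 * m%:R + 1) ^+ 2 = z ^+ 2.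
Proof.
split=> [[[m|m] ->]|[m /eqP]].
- by exists m; rewrite rmorphD rmorphM.
- exists m; rewrite NegzE rmorphD rmorphM rmorphN rmorph1 /=.
  have -> : (m.+1%:Z%:~R : R[i]) = m%:R + 1 by rewrite natr1.
  by have -> : (2%:~R : R[i]) = 2 by []; ring.
rewrite eqf_sqr => /orP[] /eqP h.
  exists (m : int); rewrite -h rmorphD rmorphM rmorph1 /=.
  by have -> : (2%:~R : R[i]) = 2 by [].
exists (- (m.+1 : int)); rewrite -[z]opprK -h rmorphD rmorphM rmorphN rmorph1 /=.
have -> : (m.+1%:Z%:~R : R[i]) = m%:R + 1 by rewrite natr1.
by have -> : (2%:~R : R[i]) = 2 by []; ring.
Qed.

Lemma even_integerP (z : R[i]) :
  even_integer z <-> exists m : nat, (2 * m%:R + 1) ^+ 2 = (1 - z) ^+ 2.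
Proof.
split=> [[k ->]|[m /eqP]].
  have /odd_integerP : odd_integer (1 - (2 * k)%:~R : R[i]).
    by exists (- k); rewrite !rmorphD !rmorphM !rmorphN rmorph1 /=; ring.
  by [].
move=> /eqP h; have /odd_integerP : exists m : nat, (2 * m%:R + 1) ^+ 2 = (1 - z) ^+ 2 by exists m.
move=> [k hk]; exists (- k).
have -> : z = 1 - (1 - z) by ring.
by rewrite hk !rmorphD !rmorphM !rmorphN rmorph1 /=; ring.
Qed.

(** kappa_(2m+1) kappa_(2m+2) is (u^2 - a^2)(u^2 - alpha^2)(u^2 - beta^2) / (16 u^2)
    with u = 2 m + 1 and a = 1 - alpha - beta. *)
Lemma parityP j : parity_condition alpha beta <->
  exists m, kap j (2 * m).+1 * kap j (2 * m).+2 = 0.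
Proof.
have E m : kap j (2 * m).+1 * kap j (2 * m).+2 = 0 <->
   [\/ (2 * m%:R + 1) ^+ 2 = (1 - (alpha + beta)) ^+ 2,
       (2 * m%:R + 1) ^+ 2 = alpha ^+ 2 | (2 * m%:R + 1) ^+ 2 = beta ^+ 2].
  transitivity (kappa_odd_num alpha beta j m * kappa_even_num alpha beta j m = 0).
    by split=> /eqP h; apply/eqP; move: h; rewrite !mulf_eq0 ?kappa_odd_eq0 ?kappa_even_eq0.
  rewrite kappa_num_prod opprD addrA.
  split=> [/eqP|h].
    rewrite !mulf_eq0 !subr_eq0 -orbA => /or3P[] /eqP h; [exact: Or31|exact: Or32|exact: Or33].
  by apply/eqP; rewrite !mulf_eq0 !subr_eq0; case: h => ->; rewrite eqxx ?orbT.
split=> [[/odd_integerP[m h]|[/odd_integerP[m h]|/even_integerP[m h]]]|[m /E[] h]].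
- by exists m; apply/E; apply: Or32.
- by exists m; apply/E; apply: Or33.
- by exists m; apply/E; apply: Or31.
- by right; right; apply/even_integerP; exists m.
- by left; apply/odd_integerP; exists m.
- by right; left; apply/odd_integerP; exists m.
Qed.

Lemma nat_half_cases n : exists m, n = (2 * m)%N \/ n = (2 * m).+1.
Proof.
exists n./2; rewrite -{1 3}[n]odd_double_half mul2n.
by case: (odd n); [right|left].
Qed.

Lemma kappa_neq0 j : ~ parity_condition alpha beta ->
  forall n, (0 < n)%N -> kap j n != 0.
Proof.
move=> np [//|n] _; apply/eqP => h; apply: np; apply/(parityP j).
have [m [E|E]] := nat_half_cases n; exists m; rewrite -E.
  by rewrite h mul0r.
by rewrite h mulr0.
Qed.

End Parity.

(** * The dominant coefficient of a solution *)

Section Functional.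
Context {R : realType}.
Variables (alpha beta : R[i]) (j : nat).
Local Notation kap := (kappa alpha beta j).
Local Notation d := (divergence_point alpha beta j).
Local Notation ys := (kappa_sol alpha beta j).

(** The terms of kappa_(2m+1) and kappa_(2m+2) below those that determine the
    exponents of the Euler system. *)
Definition rem_odd m : R[i] := kap (2 * m).+1 - m%:R ^+ 2 - (1 / 2 + d) * m%:R.
Definition rem_even m : R[i] := kap (2 * m).+2 - m%:R ^+ 2 - (3 / 2 - d) * m%:R.

(** With the signs of the j-th family put into (a, b, c), one has
    d = (1 + a + b + c) / 2; the remainders then follow from expanding
    (u + a)(u + b)(u + c) / (4 u) in u = 2 m + 1. *)
Lemma rem_form : exists s1 s2 s3 : R[i], forall m,
  rem_odd m = s1 + s3 / (2 * m%:R + 1) /\ rem_even m = s2 - s3 / (2 * m%:R + 1).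
Proof.
suff [a [b [c [hd ho he]]]] : exists a b c : R[i], [/\ d = (1 + a + b + c) / 2,
   forall m, kappa_odd_num alpha beta j m = (2 * m%:R + 1 + a) * (2 * m%:R + 1 + b) * (2 * m%:R + 1 + c) &
   forall m, kappa_even_num alpha beta j m = (2 * m%:R + 1 - a) * (2 * m%:R + 1 - b) * (2 * m%:R + 1 - c)].
  exists ((1 + (a + b + c) + (a * b + a * c + b * c)) / 4).
  exists ((1 - (a + b + c) + (a * b + a * c + b * c)) / 4).
  exists (a * b * c / 4) => m; have h := odd_neq0 (R := R) m.
  rewrite /rem_odd /rem_even kappa_oddE kappa_evenE ho he hd.
  by split; field; rewrite h.
case: j => [|[|[|k]]].
- by exists (- (1 - alpha - beta)), (- alpha), beta; split=> [|m|m];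
    rewrite /divergence_point /kappa_odd_num /kappa_even_num; [field|ring|ring].
- by exists (1 - alpha - beta), alpha, beta; split=> [|m|m];
    rewrite /divergence_point /kappa_odd_num /kappa_even_num; [field|ring|ring].
- by exists (1 - alpha - beta), (- alpha), (- beta); split=> [|m|m];
    rewrite /divergence_point /kappa_odd_num /kappa_even_num; [field|ring|ring].
- by exists (- (1 - alpha - beta)), (- alpha), beta; split=> [|m|m];
    rewrite /divergence_point /kappa_odd_num /kappa_even_num; [field|ring|ring].
Qed.

Lemma rem_bounded : exists K : R, (forall m, normc (rem_odd m) <= K) /\ (forall m, normc (rem_even m) <= K).
Proof.
have [s1 [s2 [s3 h]]] := rem_form.
have b m : normc (s3 / (2 * m%:R + 1)) <= normc s3.
  rewrite normcM normcV -natrM natr1 normc_nat ler_pdivrMr ?ltr0n//.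
  by rewrite ler_peMr ?normc_ge0// ler1n.
exists (normc s1 + normc s2 + normc s3); split=> m; have [ho he] := h m.
  rewrite ho; apply: le_trans (le_normcD _ _) _.
  by have := b m; have := normc_ge0 s2; lra.
rewrite he; apply: le_trans (le_normcD _ _) _; rewrite normcN.
by have := b m; have := normc_ge0 s1; lra.
Qed.

(** The normalisation under which y_(2m-1) converges. *)
Definition sol_scale x m : R[i] := (m.-1)`!%:R ^+ 2 * growth x m.

Lemma fact_neq0 m : m`!%:R != 0 :> R[i].
Proof. by rewrite pnatr_eq0 -lt0n fact_gt0. Qed.

Lemma kappa_sol_euler_system (x u v : R[i]) :
  euler_system x d rem_odd rem_even
    (fun m => (ys x u v m).1 / (m.-1)`!%:R ^+ 2)
    (fun m => (ys x u v m).2 / ((m.-1)`!%:R ^+ 2 * m%:R)).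
Proof.
case=> // m _; rewrite kappa_solS /kappa_step; case: (ys x u v m.+1) => p q /=.
have f0 := fact_neq0 m; have m1 : (m.+1%:R : R[i]) != 0 by rewrite pnatr_eq0.
have m2 : (m.+2%:R : R[i]) != 0 by rewrite pnatr_eq0.
rewrite factS natrM /rem_odd /rem_even.
have e2 : (m.+2%:R : R[i]) = m.+1%:R + 1 by rewrite natr1.
rewrite e2 in m2 *.
move: (kap _) (kap _) => k1 k2.
move: (m`!%:R : R[i]) (m.+1%:R : R[i]) f0 m1 m2 => f n f0 m1 m2.
by split; field; rewrite ?f0 ?m1 ?m2.
Qed.

Section PositiveRe.
Variable x : R[i].
Hypothesis x0 : 0 < complex.Re x.

(** The coefficient of a solution along the growing exponent, as a linear form
    in its initial values. *)
Definition dominant u v : R[i] := lim ((ys x u v m).1 / sol_scale x m @[m --> \oo]).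

Let scaled1 u v m : (ys x u v m).1 / (m.-1)`!%:R ^+ 2 / growth x m = (ys x u v m).1 / sol_scale x m.
Proof. by rewrite /sol_scale -mulrA -invfM. Qed.

Let scaled2 u v m : (ys x u v m).2 / ((m.-1)`!%:R ^+ 2 * m%:R) / growth x m =
   (ys x u v m).2 / (m%:R * sol_scale x m).
Proof. by rewrite /sol_scale -mulrA -invfM; congr (_ / _); ring. Qed.

Lemma dominant_spec : exists2 m0, (0 < m0)%N & forall u v,
  [/\ (ys x u v m).1 / sol_scale x m @[m --> \oo] --> dominant u v,
      (ys x u v m).2 / (m%:R * sol_scale x m) @[m --> \oo] --> (x - d) * dominant u v &
      (ys x u v m0).2 = (x - d) * m0%:R * (ys x u v m0).1 -> (ys x u v m0).1 != 0 ->
      dominant u v != 0].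
Proof.
have [K [h1 h2]] := rem_bounded.
have [m0 m00 h] := dominant_threshold d x0 h1 h2.
exists m0 => // u v.
have [l [c1 c2 hl]] := h _ _ (kappa_sol_euler_system x u v).
have c1' : (ys x u v m).1 / sol_scale x m @[m --> \oo] --> l.
  apply: cvg_trans c1; apply: near_eq_cvg; apply: nearW => m /=; by rewrite scaled1.
have c2' : (ys x u v m).2 / (m%:R * sol_scale x m) @[m --> \oo] --> (x - d) * l.
  apply: cvg_trans c2; apply: near_eq_cvg; apply: nearW => m /=; by rewrite scaled2.
have -> : dominant u v = l by apply: cvg_lim c1'; exact: hausdorffC.
split=> // e0 p0; apply: hl; last by rewrite mulf_neq0// invr_eq0 expf_neq0// fact_neq0.
have f0 := fact_neq0 m0.-1; have m0n : (m0%:R : R[i]) != 0 by rewrite pnatr_eq0 -lt0n.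
by rewrite e0; field; rewrite f0 m0n.
Qed.

Lemma dominant_cvg1 u v : (ys x u v m).1 / sol_scale x m @[m --> \oo] --> dominant u v.
Proof. by have [m0 _ h] := dominant_spec; have [] := h u v. Qed.

Lemma dominant_cvg2 u v :
  (ys x u v m).2 / (m%:R * sol_scale x m) @[m --> \oo] --> (x - d) * dominant u v.
Proof. by have [m0 _ h] := dominant_spec; have [] := h u v. Qed.

Lemma kappa_sol_linear c c' u v u' v' m :
  ys x (c * u + c' * u') (c * v + c' * v') m =
  (c * (ys x u v m).1 + c' * (ys x u' v' m).1, c * (ys x u v m).2 + c' * (ys x u' v' m).2).
Proof. exact: cf_sol_linear. Qed.

Lemma dominant_linear c c' u v u' v' :
  dominant (c * u + c' * u') (c * v + c' * v') = c * dominant u v + c' * dominant u' v'.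
Proof.
have h : c * ((ys x u v m).1 / sol_scale x m) + c' * ((ys x u' v' m).1 / sol_scale x m) @[m --> \oo] -->
   c * dominant u v + c' * dominant u' v'.
  exact: (cvgcD (cvgcM (cvg_cst _) (@dominant_cvg1 u v)) (cvgcM (cvg_cst _) (@dominant_cvg1 u' v'))).
have h' : c * ((ys x u v m).1 / sol_scale x m) + c' * ((ys x u' v' m).1 / sol_scale x m) @[m --> \oo] -->
   dominant (c * u + c' * u') (c * v + c' * v').
  have := @dominant_cvg1 (c * u + c' * u') (c * v + c' * v').
  move=> g; apply: cvg_trans g; apply: near_eq_cvg; apply: nearW => m /=.
  by rewrite kappa_sol_linear /= mulrDl !mulrA.
exact: cvgc_unique h' h.
Qed.

Hypothesis kap_neq0 : forall n, (0 < n)%N -> kap n != 0.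

(** The recurrence can be run backwards when no partial numerator is 0. *)
Lemma kappa_sol_surj m p q : exists u v, ys x u v m = (p, q).
Proof.
elim: m p q => [|m IH] p q; first by exists p, q; rewrite /kappa_sol muln0.
have k1 := kap_neq0 (ltn0Sn (2 * m)); have k2 := kap_neq0 (ltn0Sn (2 * m).+1).
pose b := (q - (x ^+ 2 - d ^+ 2) * p) / kap (2 * m).+2.
have [u [v h]] := IH ((p - b) / kap (2 * m).+1) b.
exists u, v; rewrite kappa_solS h /kappa_step /=; congr (_, _).
  by rewrite mulrCA mulfV// mulr1 addrC subrK.
rewrite mulrCA mulfV// mulr1 [b + _]addrC subrK /b mulrCA mulfV// mulr1.
by rewrite addrC subrK.
Qed.

Lemma dominant_nontrivial : exists u v, dominant u v != 0.
Proof.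
have [m0 m00 h] := dominant_spec.
have [u [v huv]] := kappa_sol_surj m0 1 ((x - d) * m0%:R).
exists u, v; have [_ _] := h u v; rewrite huv /= mulr1; apply => //; exact: oner_neq0.
Qed.

(** The initial states of numerators and denominators form a basis, and the
    linear form [dominant] is not 0. *)
Lemma dominant_basis : (dominant 1 (kappa_b0 alpha beta j x) != 0) || (dominant 0 1 != 0).
Proof.
rewrite -negb_and; apply/negP => /andP[/eqP h1 /eqP h2].
have [u [v]] := dominant_nontrivial; apply/negP; rewrite negbK.
have -> : dominant u v = u * dominant 1 (kappa_b0 alpha beta j x) + (v - u * kappa_b0 alpha beta j x) * dominant 0 1.
  by rewrite -dominant_linear; congr dominant; ring.
by rewrite h1 h2 !mulr0 addr0.
Qed.

End PositiveRe.

Lemma growth_shift (x : R[i]) m : 0 < complex.Re x ->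
  growth (x + 2) m.+1 = growth x m.+1 *
   ((m.+1%:R + 1 / 2 + x) * (m.+1%:R + 3 / 2 + x) / ((3 / 2 + x) * (5 / 2 + x))).
Proof.
move=> x0.
have s k : (k%:R + 1 / 2 + x : R[i]) != 0 by exact: shift_neq0.
have s3 : 3 / 2 + x != 0 by have := s 1%N; congr (_ != _); field.
have s5 : 5 / 2 + x != 0 by have := s 2%N; congr (_ != _); field.
elim: m => [|m IH].
  rewrite /growth !big_geq// [RHS]mul1r.
  have -> : (1%:R + 1 / 2 + x) * (1%:R + 3 / 2 + x) = (3 / 2 + x) * (5 / 2 + x) by field.
  by rewrite divff// mulf_neq0.
rewrite !(growthS _ (ltn0Sn m)) IH.
have s0 := s m.+1; have m0 : (m.+1%:R : R[i]) != 0 by rewrite pnatr_eq0.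
have -> : (m.+2%:R : R[i]) = m.+1%:R + 1 by rewrite natr1.
move: (m.+1%:R : R[i]) s0 m0 => n s0 m0.
have s3' : 3 + x * 2 != 0.
  have -> : 3 + x * 2 = 2 * (3 / 2 + x) by field.
  by rewrite mulf_neq0// pnatr_eq0.
have s5' : 5 + x * 2 != 0.
  have -> : 5 + x * 2 = 2 * (5 / 2 + x) by field.
  by rewrite mulf_neq0// pnatr_eq0.
by field; rewrite m0 ?s3 ?s5 ?s3' ?s5'.
Qed.

(** In the coordinates (y_(2m-1), y_(2m) / m) the first row of T_m(x) / m^2
    tends to (8 (x + d), 8), whose value at the eigenvector (1, x - d) is 16 x; the other factor compares the
    growth factors at x and x + 2. *)
Lemma dominant_shift (x u v u' v' : R[i]) : 0 < complex.Re x ->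
  shift_map alpha beta j x 0 (u, v) = (u', v') ->
  dominant (x + 2) u' v' = 16 * x * ((3 / 2 + x) * (5 / 2 + x)) * dominant x u v.
Proof.
move=> x0 hl.
have x20 : 0 < complex.Re (x + 2) by rewrite raddfD /= ltr_wpDr.
have c1 := @dominant_cvg1 x x0 u v; have c2 := @dominant_cvg2 x x0 u v.
have c3 := @dominant_cvg1 (x + 2) x20 u' v'.
rewrite -cvg_shiftS in c1; rewrite -cvg_shiftS in c2; rewrite -cvg_shiftS in c3.
have inv0 := cvgc_inv_nat (R := R).
set s := (3 / 2 + x) * (5 / 2 + x).
have s0 k : (k%:R + 1 / 2 + x : R[i]) != 0 by exact: shift_neq0.
have sn : s != 0.
  rewrite mulf_neq0//; first by have := s0 1%N; congr (_ != _); field.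
  by have := s0 2%N; congr (_ != _); field.
pose g := quotient_num alpha beta x.
pose num m : R[i] := g * (m.+1%:R^-1 * m.+1%:R^-1) + 4 * (d ^+ 2 - x ^+ 2) * m.+1%:R^-1 + 8 * (x + d).
pose den m : R[i] := (1 + (1 / 2 + x) * m.+1%:R^-1) * (1 + (3 / 2 + x) * m.+1%:R^-1).
have cnum : num m @[m --> \oo] --> g * (0 * 0) + 4 * (d ^+ 2 - x ^+ 2) * 0 + 8 * (x + d).
  exact: (cvgcD (cvgcD (cvgcM (cvg_cst _) (cvgcM inv0 inv0)) (cvgcM (cvg_cst _) inv0)) (cvg_cst _)).
have cden : den m @[m --> \oo] --> (1 + (1 / 2 + x) * 0) * (1 + (3 / 2 + x) * 0).
  exact: (cvgcM (cvgcD (cvg_cst _) (cvgcM (cvg_cst _) inv0)) (cvgcD (cvg_cst _) (cvgcM (cvg_cst _) inv0))).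
have e1 : g * (0 * 0) + 4 * (d ^+ 2 - x ^+ 2) * 0 + 8 * (x + d) = 8 * (x + d) by ring.
have e2 : (1 + (1 / 2 + x) * 0) * (1 + (3 / 2 + x) * 0) = 1 :> R[i] by ring.
rewrite e1 in cnum; rewrite e2 in cden.
have h : (num m * ((ys x u v m.+1).1 / sol_scale x m.+1) + 8 * ((ys x u v m.+1).2 / (m.+1%:R * sol_scale x m.+1))) * s / den m
    @[m --> \oo] --> (8 * (x + d) * dominant x u v + 8 * ((x - d) * dominant x u v)) * s / 1.
  exact: (cvgcM (cvgcM (cvgcD (cvgcM cnum c1) (cvgcM (cvg_cst _) c2)) (cvg_cst _)) (cvgcV (oner_neq0 _) cden)).
have E : (8 * (x + d) * dominant x u v + 8 * ((x - d) * dominant x u v)) * s / 1 = 16 * x * s * dominant x u v.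
  by field.
rewrite E in h.
have pw m : (ys (x + 2) u' v' m.+1).1 / sol_scale (x + 2) m.+1 =
   (num m * ((ys x u v m.+1).1 / sol_scale x m.+1) + 8 * ((ys x u v m.+1).2 / (m.+1%:R * sol_scale x m.+1))) * s / den m.
  rewrite -(shift_map_sol m.+1 hl); case: (ys x u v m.+1) => p q; rewrite /shift_map /= /sol_scale growth_shift//=.
  rewrite /num /den /g -/s.
  have f0 := fact_neq0 m; have g0 := growth_neq0 x0 m.+1.
  have m0 : (m.+1%:R : R[i]) != 0 by rewrite pnatr_eq0.
  have t1 := s0 m.+1; have t2 := s0 m.+2.
  rewrite -[m.+2%:R]natr1 in t2.
  move: (m.+1%:R : R[i]) m0 t1 t2 => n m0 t1 t2.
  have t2' : n + 3 / 2 + x != 0 by move: t2; congr (_ != _); field.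
  have t3 : 2 * n + (1 + x * 2) != 0.
    have -> : 2 * n + (1 + x * 2) = 2 * (n + 1 / 2 + x) by field.
    by rewrite mulf_neq0// pnatr_eq0.
  have t4 : 2 * n + (3 + x * 2) != 0.
    have -> : 2 * n + (3 + x * 2) = 2 * (n + 3 / 2 + x) by field.
    by rewrite mulf_neq0// pnatr_eq0.
  clear E h; move: s sn => S0 sn.
  by field; rewrite m0 t4 t3 g0 f0 sn.
have h' : (num m * ((ys x u v m.+1).1 / sol_scale x m.+1) + 8 * ((ys x u v m.+1).2 / (m.+1%:R * sol_scale x m.+1))) * s / den m
    @[m --> \oo] --> dominant (x + 2) u' v'.
  by apply: cvg_trans c3; apply: near_eq_cvg; apply: nearW => m; exact: pw.
exact: cvgc_unique h' h.
Qed.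

End Functional.

(** * The values of the fractions *)

Section Values.
Context {R : realType}.
Variables (alpha beta : R[i]) (j : nat).
Local Notation kap := (kappa alpha beta j).
Local Notation lam := (lambda alpha beta j).
Local Notation d := (divergence_point alpha beta j).
Local Notation ys := (kappa_sol alpha beta j).
Local Notation p := (p_coef alpha beta).
Local Notation bqx := (p_denom alpha beta).
Local Notation bq0x := (p_denom0 alpha beta).
Local Notation y0x := (kappa_b0 alpha beta j).

Lemma lambda0E (x : R[i]) : lam x 0 / 2 = y0x x.
Proof. by rewrite (_ : 0%N = 2 * 0)%N// lambda_even. Qed.

Lemma p_sol_A (x : R[i]) n : (cf_sol p (bqx x) 1 (bq0x x) n).2 = (ys x 1 (y0x x) n.+1).1.
Proof. by rewrite (@contraction _ alpha beta j x 1 (y0x x))//= mulr1 (p_denom0E _ _ j). Qed.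

Lemma p_sol_B (x : R[i]) n : (cf_sol p (bqx x) 0 1 n).2 = (ys x 0 1 n.+1).1.
Proof. by rewrite (@contraction _ alpha beta j x 0 1)//= mulr0 addr0. Qed.

Lemma kappa_sol_odd (x u v : R[i]) m : (ys x u v m.+1).1 = (cf_sol kap (lam x) u v (2 * m).+1).2.
Proof. by rewrite /kappa_sol mulnS. Qed.

Lemma cvg_even_odd (T : topologicalType) (f : nat -> T) (l : T) :
  f (2 * m)%N @[m --> \oo] --> l -> f (2 * m).+1 @[m --> \oo] --> l -> f @ \oo --> l.
Proof.
move=> h1 h2 U hU; have [M1 _ m1] := h1 _ hU; have [M2 _ m2] := h2 _ hU.
exists (2 * (maxn M1 M2)).+1 => // n /= hn.
have [m [E|E]] := nat_half_cases n; rewrite E in hn *.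
  apply: m1 => /=; apply: leq_trans (leq_maxl M1 M2) _.
  by move: (ltnW hn); rewrite leq_pmul2l.
apply: m2 => /=; apply: leq_trans (leq_maxr M1 M2) _.
by move: hn; rewrite ltnS leq_pmul2l.
Qed.

(** The form of both claims of the theorem, reduced to homogeneous
    coordinates. *)
Lemma cf_conclusion (x b0 A B : R[i]) (a b : nat -> R[i]) :
  (A != 0) || (B != 0) -> Gamma_quotient alpha beta x = ratio_pt (2 * B) A ->
  cf_approximant b0 a b n @[n --> \oo] --> ratio_pt A B ->
  cf_converges b0 a b /\ Gamma_quotient alpha beta x = sph_div 2 (cf_value b0 a b).
Proof.
move=> nz hG hc; split; first exact: cvgP hc.
rewrite hG /cf_value (sphere_lim hc) sph_div_ratio//.
Qed.

Section NonTerminating.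
Hypothesis np : ~ parity_condition alpha beta.
Let kap0 : forall n, (0 < n)%N -> kap n != 0 := @kappa_neq0 R alpha beta j np.
Let p0 n : (0 < n)%N -> p n != 0.
Proof.
case: n => // n _; rewrite (p_coefE _ _ j) oppr_eq0 mulf_neq0//; exact: kap0.
Qed.

Definition limA x := dominant alpha beta j x 1 (y0x x).
Definition limB x := dominant alpha beta j x 0 1.

Let D (x : R[i]) := 0 < complex.Re x.

Let D_shift x : D x -> D (x + 2).
Proof. by rewrite /D raddfD /= => h; rewrite ltr_wpDr. Qed.

Let AB_neq0 x : D x -> (limA x != 0) || (limB x != 0).
Proof. by move=> Dx; apply: dominant_basis => //; exact: kap0. Qed.

Let t (x : R[i]) := 16 * x * ((3 / 2 + x) * (5 / 2 + x)).

Let t_neq0 x : D x -> t x != 0.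
Proof.
move=> Dx; have h (a : R) : 0 <= a -> a%:C%C + x != 0.
  move=> a0; have : 0 < complex.Re (a%:C%C + x) by rewrite raddfD /= ltr_wpDl.
  by apply: contraTneq => ->; rewrite ltxx.
rewrite !mulf_neq0 ?pnatr_eq0//.
- by have := h 0 (lexx 0); rewrite rmorph0 add0r.
- by have := h (3 / 2); rewrite fmorph_div !rmorph_nat; apply; rewrite divr_ge0.
- by have := h (5 / 2); rewrite fmorph_div !rmorph_nat; apply; rewrite divr_ge0.
Qed.

Let A_shift x : D x -> t x * limA x = quotient_num alpha beta x * limA (x + 2).
Proof.
move=> Dx; have Dx2 := D_shift Dx.
rewrite /limA /t -(dominant_shift Dx (shift_map0_A alpha beta j x)).
have := @dominant_linear R alpha beta j (x + 2) Dx2 (quotient_num alpha beta x) 0 1 (y0x (x + 2)) 0 0.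
by rewrite !mul0r !addr0.
Qed.

Let B_shift x : D x -> t x * limB x = quotient_den alpha beta x * limB (x + 2).
Proof.
move=> Dx; have Dx2 := D_shift Dx.
rewrite /limB /t -(dominant_shift Dx (shift_map0_B alpha beta j x)).
have := @dominant_linear R alpha beta j (x + 2) Dx2 (quotient_den alpha beta x) 0 0 1 0 0.
by rewrite !mul0r !addr0.
Qed.

Let AB_large x : D x -> worpitzky_threshold alpha beta <= complex.Re (x ^+ 2) ->
  normc (limA x - bq0x x * limB x) <= 2 * normc (p 1) * normc (limB x).
Proof.
move=> Dx hx.
have cA := @dominant_cvg1 _ alpha beta j x Dx 1 (y0x x).
have cB := @dominant_cvg1 _ alpha beta j x Dx 0 1.
have c1 : normc ((ys x 1 (y0x x) m).1 / sol_scale x m - bq0x x * ((ys x 0 1 m).1 / sol_scale x m)) -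
   2 * normc (p 1) * normc ((ys x 0 1 m).1 / sol_scale x m) @[m --> \oo] -->
   normc (limA x - bq0x x * limB x) - 2 * normc (p 1) * normc (limB x).
  apply: cvgB; first exact: (cvgc_norm (cvgcB cA (cvgcM (cvg_cst _) cB))).
  by apply: cvgM; [exact: cvg_cst|exact: (cvgc_norm cB)].
rewrite -subr_le0; apply: (cvgr_to_le c1).
exists 1%N => // -[//|m] _ /=; rewrite subr_le0.
have hW := worpitzky hx (n := m) (fun k hk => p0 (proj1 (andP hk))).
rewrite p_sol_A p_sol_B in hW.
rewrite mulrA -mulrBl !normcM mulrA; apply: ler_wpM2r; first exact: normc_ge0.
exact: hW.
Qed.

Lemma nonterminating_quotient x : D x -> Gamma_quotient alpha beta x = ratio_pt (2 * limB x) (limA x).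
Proof.
move=> Dx.
apply: (Gamma_quotient_separated D_shift AB_neq0 A_shift B_shift
  (worpitzky_threshold_ge0 alpha beta) AB_large Dx _ t_neq0).
apply: filterS (near_dist x Dx) => z zx; rewrite /D.
have := le_lt_trans (Re_le_normc (z - x)) zx.
rewrite raddfB /= ltr_norml => /andP[h _]; lra.
Qed.

Lemma sol_scale_neq0 x m : D x -> sol_scale x m != 0.
Proof. by move=> Dx; rewrite mulf_neq0 ?growth_neq0// expf_neq0// fact_neq0. Qed.

Lemma nonterminating_odd x : D x ->
  ratio_pt (ys x 1 (y0x x) m.+1).1 (ys x 0 1 m.+1).1 @[m --> \oo] --> ratio_pt (limA x) (limB x).
Proof.
move=> Dx.
have cA := @dominant_cvg1 _ alpha beta j x Dx 1 (y0x x).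
have cB := @dominant_cvg1 _ alpha beta j x Dx 0 1.
rewrite -cvg_shiftS in cA; rewrite -cvg_shiftS in cB.
have h : ratio_pt ((ys x 1 (y0x x) m.+1).1 / sol_scale x m.+1) ((ys x 0 1 m.+1).1 / sol_scale x m.+1) @[m --> \oo] -->
   ratio_pt (limA x) (limB x) by exact: (ratio_pt_cvg (AB_neq0 Dx) cA cB).
apply: cvg_trans h; apply: near_eq_cvg; apply: nearW => m /=.
by rewrite ![_ / sol_scale _ _]mulrC ratio_ptZ// invr_eq0 sol_scale_neq0.
Qed.

(** Both even-indexed coordinates carry the factor x - d; for x = d they tend to
    0 relative to the odd-indexed ones and their ratio is lost. *)
Lemma nonterminating_even x : D x -> x <> d ->
  ratio_pt (ys x 1 (y0x x) m).2 (ys x 0 1 m).2 @[m --> \oo] --> ratio_pt (limA x) (limB x).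
Proof.
move=> Dx /eqP xd; have xd0 : x - d != 0 by rewrite subr_eq0.
have cA := @dominant_cvg2 _ alpha beta j x Dx 1 (y0x x).
have cB := @dominant_cvg2 _ alpha beta j x Dx 0 1.
have nz : ((x - d) * limA x != 0) || ((x - d) * limB x != 0).
  by rewrite !mulf_eq0 (negPf xd0) AB_neq0.
have h : ratio_pt ((ys x 1 (y0x x) m).2 / (m%:R * sol_scale x m)) ((ys x 0 1 m).2 / (m%:R * sol_scale x m)) @[m --> \oo] -->
   ratio_pt ((x - d) * limA x) ((x - d) * limB x) by exact: (ratio_pt_cvg nz cA cB).
rewrite ratio_ptZ// in h.
apply: cvg_trans h; apply: near_eq_cvg; exists 1%N => // m /= m0.
rewrite ![_ / (_ * sol_scale _ _)]mulrC ratio_ptZ// invr_eq0 mulf_neq0 ?sol_scale_neq0//.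
by rewrite pnatr_eq0 -lt0n.
Qed.

Lemma nonterminating_kappa x : D x -> x <> d ->
  cf_approximant (lam x 0 / 2) kap (lam x) n @[n --> \oo] --> ratio_pt (limA x) (limB x).
Proof.
move=> Dx xd.
have E n : cf_approximant (lam x 0 / 2) kap (lam x) n =
    ratio_pt (cf_sol kap (lam x) 1 (y0x x) n).2 (cf_sol kap (lam x) 0 1 n).2.
  rewrite lambda0E; have [] // := @cf_approximant_sol _ kap (lam x) (y0x x) n.
  by move=> k /andP[k0 _]; exact: kap0.
apply: cvg_even_odd.
  have h := nonterminating_even Dx xd.
  by apply: cvg_trans h; apply: near_eq_cvg; apply: nearW => m /=; rewrite E.
have h := nonterminating_odd Dx.
by apply: cvg_trans h; apply: near_eq_cvg; apply: nearW => m; rewrite E !kappa_sol_odd.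
Qed.

Lemma nonterminating_p x : D x ->
  cf_approximant (bq0x x) p (bqx x) n @[n --> \oo] --> ratio_pt (limA x) (limB x).
Proof.
move=> Dx; have h := nonterminating_odd Dx.
apply: cvg_trans h; apply: near_eq_cvg; apply: nearW => m.
have [k /andP[k0 _]|-> _] := @cf_approximant_sol _ p (bqx x) (bq0x x) m; first exact: p0.
by rewrite p_sol_A p_sol_B.
Qed.

End NonTerminating.

Section Terminating.
Variable N : nat.
Hypothesis kapN : kap N.+1 = 0.
Hypothesis kap_neq0 : forall k, (0 < k <= N)%N -> kap k != 0.

Definition termA x := (cf_sol kap (lam x) 1 (y0x x) N).2.
Definition termB x := (cf_sol kap (lam x) 0 1 N).2.

Lemma term_neq0 x : (termA x != 0) || (termB x != 0).
Proof. by have [] := @cf_approximant_sol _ kap (lam x) (y0x x) N. Qed.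

(** If the vanishing partial numerator has odd index 2 m + 1, then
    y_(2m+1) = y_(2m); so in both parities the last convergent has the odd
    index that the contraction sees. *)
Lemma term_kappa_sol (x u v : R[i]) : (cf_sol kap (lam x) u v N).2 = (ys x u v (N./2).+1).1.
Proof.
rewrite kappa_sol_odd; have [m [E|E]] := nat_half_cases N.
  have -> : N./2 = m by rewrite E mul2n doubleK.
  rewrite cf_solS lambda_odd mul1r -E kapN mul0r addr0 //.
have -> : N./2 = m by rewrite E mul2n /= uphalf_double.
by rewrite E.
Qed.

Lemma p_term : p (N./2).+1 = 0.
Proof.
rewrite (p_coefE _ _ j); have [m [E|E]] := nat_half_cases N.
  have -> : N./2 = m by rewrite E mul2n doubleK.
  by rewrite -E kapN mul0r oppr0.
have -> : N./2 = m by rewrite E mul2n /= uphalf_double.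
by rewrite -E kapN mulr0 oppr0.
Qed.

Lemma p_term_neq0 k : (0 < k <= N./2)%N -> p k != 0.
Proof.
case: k => // k /=; rewrite (p_coefE _ _ j) => kN; rewrite oppr_eq0.
have h : ((2 * k).+2 <= N)%N.
  have -> : (2 * k).+2 = (k.+1).*2 by rewrite doubleS mul2n.
  by rewrite -geq_half_double.
by apply: mulf_neq0; apply: kap_neq0 => //; exact: ltnW.
Qed.

Lemma term_kappa x :
  cf_approximant (lam x 0 / 2) kap (lam x) n @[n --> \oo] --> ratio_pt (termA x) (termB x).
Proof. by rewrite lambda0E; exact: cf_terminates. Qed.

Lemma term_p x :
  cf_approximant (bq0x x) p (bqx x) n @[n --> \oo] --> ratio_pt (termA x) (termB x).
Proof.
have h := @cf_terminates _ p (bqx x) (bq0x x) N./2 p_term p_term_neq0.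
by rewrite p_sol_A p_sol_B -!term_kappa_sol in h.
Qed.

Lemma term_large x : worpitzky_threshold alpha beta <= complex.Re (x ^+ 2) ->
  normc (termA x - bq0x x * termB x) <= 2 * normc (p 1) * normc (termB x).
Proof.
move=> hx; have := worpitzky hx p_term_neq0.
by rewrite p_sol_A p_sol_B -!term_kappa_sol.
Qed.

(** At a vanishing partial numerator T_m maps the last convergent to a multiple
    of itself: its lower left entry contains kappa_(2m+1), and when
    kappa_(2m+2) = 0 the state is proportional to (1, x^2 - d^2). *)
Lemma term_shift : exists t : R[i] -> R[i], forall x u v u' v',
  shift_map alpha beta j x 0 (u, v) = (u', v') ->
  t x * (cf_sol kap (lam x) u v N).2 = (cf_sol kap (lam (x + 2)) u' v' N).2.
Proof.
have [m [E|E]] := nat_half_cases N.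
  (* The entry T_22, alone in its row since kappa_(2m+1) = 0. *)
  exists (fun x => quotient_den alpha beta x + 4 * m%:R * ((x + 2) ^+ 2 - d ^+ 2) + 8 * m%:R ^+ 2 * (x + 2 - d)).
  move=> x u v u' v' hl; have := shift_map_sol m hl; rewrite /kappa_sol -E => <-.
  rewrite /shift_map /=; have k0 : kappa_odd_num alpha beta j m = 0.
    by apply/eqP; rewrite -kappa_odd_eq0 -E kapN.
  by rewrite k0 mulr0 mul0r add0r.
(* The first row of T applied to (1, x^2 - d^2). *)
exists (fun x => quotient_num alpha beta x + 4 * m.+1%:R * (d ^+ 2 - x ^+ 2) + 8 * m.+1%:R ^+ 2 * (x + d) +
   8 * m.+1%:R * (x ^+ 2 - d ^+ 2)).
move=> x u v u' v' hl.
have hY : (ys x u v m.+1).2 = (x ^+ 2 - d ^+ 2) * (ys x u v m.+1).1.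
  by rewrite kappa_solS /kappa_step -E kapN mul0r addr0.
rewrite E -!kappa_sol_odd -(shift_map_sol m.+1 hl); move: hY.
by case: (ys x u v m.+1) => p1 p2; rewrite /shift_map /= => ->; ring.
Qed.

Lemma cf_sol_continuous (a : nat -> R[i]) (b : R[i] -> nat -> R[i]) (u : R[i]) (v : R[i] -> R[i]) (x : R[i]) n :
  (forall k, b z k @[z --> x] --> b x k) -> v z @[z --> x] --> v x ->
  ((cf_sol a (b z) u (v z) n).1 @[z --> x] --> (cf_sol a (b x) u (v x) n).1) /\
  ((cf_sol a (b z) u (v z) n).2 @[z --> x] --> (cf_sol a (b x) u (v x) n).2).
Proof.
move=> hb hv; elim: n => [|n [IH1 IH2]].
  by split; [exact: (@cvg_cst R[i] u R[i] (nbhs x))|exact: hv].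
split; first exact: IH2.
exact: (cvgcD (cvgcM (hb n.+1) IH2) (cvgcM (cvg_cst _) IH1)).
Qed.

Lemma lambda_continuous (x : R[i]) k : lam z k @[z --> x] --> lam x k.
Proof.
have [m [E|E]] := nat_half_cases k; rewrite E.
  have e (z : R[i]) : lam z (2 * m)%N = z * z - d ^+ 2 by rewrite lambda_even expr2.
  have h : z * z - d ^+ 2 @[z --> x] --> x * x - d ^+ 2.
    have cx : z @[z --> x] --> x by [].
    exact: (cvgcB (cvgcM cx cx) (cvg_cst _)).
  by rewrite e; exact: (cvgc_ext e h).
have e (z : R[i]) : lam z (2 * m).+1 = 1 by rewrite lambda_odd.
by rewrite e; exact: (cvgc_ext e (@cvg_cst R[i] 1 R[i] (nbhs x) _)).
Qed.

Lemma kappa_b0_continuous (x : R[i]) : y0x z @[z --> x] --> y0x x.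
Proof.
have e (z : R[i]) : y0x z = lam z 0 / 2 by rewrite lambda0E.
have h : lam z 0 / 2 @[z --> x] --> lam x 0 / 2.
  exact: (cvgcM (@lambda_continuous x 0) (cvg_cst _)).
by rewrite e; exact: (cvgc_ext e h).
Qed.

Lemma terminating_quotient x : Gamma_quotient alpha beta x = ratio_pt (2 * termB x) (termA x).
Proof.
have [t ht] := term_shift.
have A_shift z : True -> t z * termA z = quotient_num alpha beta z * termA (z + 2).
  move=> _; rewrite /termA (ht _ _ _ _ _ (shift_map0_A alpha beta j z)).
  have := cf_sol_linear kap (lam (z + 2)) (quotient_num alpha beta z) 0 1 (y0x (z + 2)) 0 0 N.
  by rewrite !mul0r !addr0 => ->; rewrite /= ?mul0r ?addr0.
have B_shift z : True -> t z * termB z = quotient_den alpha beta z * termB (z + 2).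
  move=> _; rewrite /termB (ht _ _ _ _ _ (shift_map0_B alpha beta j z)).
  have := cf_sol_linear kap (lam (z + 2)) (quotient_den alpha beta z) 0 0 1 0 0 N.
  by rewrite !mul0r !addr0 => ->; rewrite /= ?mul0r ?addr0.
have [_ cA] := @cf_sol_continuous kap lam 1 y0x x N (@lambda_continuous x) (@kappa_b0_continuous x).
have [_ cB] := @cf_sol_continuous kap lam 0 (fun=> 1) x N (@lambda_continuous x)
  (@cvg_cst R[i] 1 R[i] (nbhs x) _).
exact: (Gamma_quotient_continuous (D := fun=> True) (fun _ _ => I) (fun z _ => term_neq0 z)
  A_shift B_shift (fun z _ => @term_large z) (fun=> I) cA cB).
Qed.

End Terminating.

Lemma parity_first_zero : parity_condition alpha beta ->
  exists N, kap N.+1 = 0 /\ forall k, (0 < k <= N)%N -> kap k != 0.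
Proof.
move=> /(parityP alpha beta j)[m /eqP]; rewrite mulf_eq0 => h.
have ex : exists n, kap n.+1 == 0 by case/orP: h => h; [exists (2 * m)%N|exists (2 * m).+1].
exists (ex_minn ex); case: ex_minnP => N /eqP hN hmin; split=> // -[//|k] /= kN.
by apply/negP => /hmin; rewrite leqNgt kN.
Qed.

End Values.

Theorem theorem1p1 (R : realType) (x alpha beta : R[i])
    (hx : 0 < complex.Re x \/ parity_condition alpha beta)
    (j : nat) (hj : (1 <= j <= 3)%N) :
  ((parity_condition alpha beta \/ x <> divergence_point alpha beta j) ->
     cf_converges (lambda alpha beta j x 0 / 2)
       (kappa alpha beta j) (lambda alpha beta j x) /\
     Gamma_quotient alpha beta x =
       sph_div 2 (cf_value (lambda alpha beta j x 0 / 2)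
                    (kappa alpha beta j) (lambda alpha beta j x))) /\
  (cf_converges ((x ^+ 2 + q_coef alpha beta 0) / 2)
     (p_coef alpha beta) (fun m => x ^+ 2 + q_coef alpha beta m) /\
   Gamma_quotient alpha beta x =
     sph_div 2 (cf_value ((x ^+ 2 + q_coef alpha beta 0) / 2)
                  (p_coef alpha beta) (fun m => x ^+ 2 + q_coef alpha beta m))).
Proof.
have [par|np] := pselect (parity_condition alpha beta).
  have [N [kN k0]] := parity_first_zero j par.
  have hG := terminating_quotient kN k0 x; have nz := term_neq0 k0 x.
  split=> [_|]; first exact: (cf_conclusion nz hG (@term_kappa R alpha beta j N kN k0 x)).
  exact: (cf_conclusion nz hG (@term_p R alpha beta j N kN k0 x)).
have x0 : 0 < complex.Re x by case: hx.
have hG := @nonterminating_quotient R alpha beta j np x x0.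
have nz : (limA alpha beta j x != 0) || (limB alpha beta j x != 0).
  by apply: dominant_basis => //; exact: kappa_neq0.
split=> [[//|xd]|].
  exact: (cf_conclusion nz hG (nonterminating_kappa np x0 xd)).
exact: (cf_conclusion nz hG (@nonterminating_p R alpha beta j np x x0)).
Qed.
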